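(* Let $\Bbbk$ be a field, let $R$ be a Poisson $\Bbbk$-algebra, and let $A=A_\mu(R,\boldsymbol\partial,\mathbf a)$ be a twisted generalized Weyl Poisson algebra (TGWPA) of type $(A_1)^n$ over $R$. Then: (1) $A$ is (isomorphic as a Poisson algebra to) a quotient of an iterated Poisson Ore extension of $R$ by a Poisson ideal. (2) $A$ is (isomorphic as a Poisson algebra to) a Poisson subalgebra of a skew Laurent Poisson algebra $R_{\mathbf p}[\mathbf t^{\pm1};\boldsymbol\partial]$ for some skew-symmetric matrix $\mathbf p\in M_n(\Bbbk)$.
   Context: All algebras are over a field $\Bbbk$. A Poisson algebra is a commutative algebra $R$ with a Lie bracket $\{,\}$ such that each $\{r,-\}$ is a derivation. A derivation $\partial$ of $R$ is a Poisson derivation if $\partial(\{r,s\})=\{\partial(r),s\}+\{r,\partial(s)\}$ for all $r,s$. An element $a$ is Poisson central if $\{a,-\}=0$. Write $[n]=\{1,\dots,n\}$. TGWPA of type $(A_1)^n$: Fix an integer $n\ge 1$. Let $R$ be a Poisson algebra, $\boldsymbol\partial=(\partial_1,\dots,\partial_n)$ an $n$-tuple of pairwise commuting Poisson derivations of $R$, and $\mathbf a=(a_1,\dots,a_n)$ an $n$-tuple of Poisson central regular (non-zero-divisor) elements of $R$. Assume there are scalars $\mu_{ij},\gamma_{ij}\in\Bbbk$ ($i\ne j$) with $\partial_j(a_i)=\gamma_{ij}a_i$ and $\gamma_{ij}+\gamma_{ji}=\mu_{ij}+\mu_{ji}$ for all $i\neq j$. Then $A_\mu(R,\boldsymbol\partial,\mathbf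 a)$ is the algebra $R[x_1,y_1,\dots,x_n,y_n]/(y_1x_1-a_1,\dots,y_nx_n-a_n)$ with Poisson bracket extending that of $R$ and given by $\{r,x_i\}=\partial_i(r)x_i$, $\{r,y_i\}=-\partial_i(r)y_i$, $\{y_i,x_i\}=\partial_i(a_i)$ for $i\in[n]$, $r\in R$, and $\{y_i,x_j\}=\mu_{ij}x_jy_i$, $\{x_i,x_j\}=(\gamma_{ij}-\mu_{ij})x_ix_j$, $\{y_i,y_j\}=(\mu_{ji}-\gamma_{ij})y_iy_j$ for $i\ne j$ in $[n]$. Poisson Ore extension: given a Poisson derivation $\partial$ of a Poisson algebra $R$, a derivation $\delta$ of $R$ is a Poisson $\partial$-derivation if $\delta(\{a,b\})=\{\delta(a),b\}+\{a,\delta(b)\}-\partial(a)\delta(b)+\delta(a)\partial(b)$ for all $a,b\in R$. The Poisson Ore extension $R[t;\partial,\delta]_P$ is the polynomial ring $R[t]$ with the Poisson bracket extending that of $R$ with $\{r,t\}=\partial(r)t+\delta(r)$. An iterated Poisson Ore extension of $R$ is obtained from $R$ by finitely many successive Poisson Ore extensions. Skew Laurent Poisson algebra: given commuting Poisson derivations $\boldsymbol\partial=(\partial_1,\dots,\partial_n)$ of $R$ and a skew-symmetric matrix $\mathbf p=(p_{ij})\in M_n(\Bbbk)$, $R_{\mathbf p}[\mathbf t^{\pm1};\boldsymbol\partial]$ is the Laurent polynomial ring $R[t_1^{\pm1},\dots,t_n^{\pm1}]$ with the Poisson bracket extending that of $R$ with $\{r,t_i^{\pm1}\}=\pm\partial_i(r)t_i^{\pm1}$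 and $\{t_i,t_j^{\pm1}\}=\pm p_{ij}t_it_j^{\pm1}$ for $i\neq j$. *)

(* Defs.v *)
From HB Require Import structures.
From mathcomp Require Import all_boot all_algebra ring_quotient.
From mathcomp Require Import mpoly.
From mathcomp Require boolp.

Set Implicit Arguments.
Unset Strict Implicit.
Unset Printing Implicit Defensive.

Import GRing.Theory.
Local Open Scope ring_scope.
Local Open Scope quotient_scope.

(* The library gives {poly S}, {mpoly S[m]} and {ideal_quot I} no algebra
   structure over the base field of S; [kalg f] is B viewed as a k-algebra along
   the structure map f. *)
Definition kalg (k : fieldType) (B : comNzRingType) (f : {rmorphism k -> B}) :
  Type := B.

Section KalgTheory.
Variables (k : fieldType) (B : comNzRingType) (f : {rmorphism k -> B}).

HB.instance Definition _ := GRing.ComNzRing.on (kalg f).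

Let scale (c : k) (b : kalg f) : kalg f := f c * b.

Fact kalg_scaleA c d b : scale c (scale d b) = scale (c * d) b.
Proof. by rewrite /scale rmorphM mulrA. Qed.

Fact kalg_scale1 : left_id 1 scale.
Proof. by move=> b; rewrite /scale rmorph1 mul1r. Qed.

Fact kalg_scaleDr : right_distributive scale +%R.
Proof. by move=> c b b'; rewrite /scale mulrDr. Qed.

Fact kalg_scaleDl b : {morph scale^~ b : c d / c + d}.
Proof. by move=> c d; rewrite /scale rmorphD mulrDl. Qed.

HB.instance Definition _ := GRing.Zmodule_isLmodule.Build k (kalg f)
  kalg_scaleA kalg_scale1 kalg_scaleDr kalg_scaleDl.

Fact kalg_scaleAl c (u v : kalg f) : c *: (u * v) = (c *: u) * v.
Proof. exact: mulrA. Qed.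

HB.instance Definition _ := GRing.Lmodule_isLalgebra.Build k (kalg f)
  kalg_scaleAl.
HB.instance Definition _ := GRing.Lalgebra_isComAlgebra.Build k (kalg f).

End KalgTheory.

Definition kpoly (k : fieldType) (S : comAlgType k) : comAlgType k :=
  kalg (@polyC S \o in_alg S).

Definition kmpoly (k : fieldType) (S : comAlgType k) (m : nat) : comAlgType k :=
  kalg (@mpolyC m S \o in_alg S).

Definition kquot (k : fieldType) (S : comAlgType k) (I : idealr S) :
  comAlgType k := kalg (\pi_({ideal_quot I}) \o in_alg S).

Definition kpi (k : fieldType) (S : comAlgType k) (I : idealr S) (s : S) :
  kquot I := \pi_({ideal_quot I}) s.
Definition krepr (k : fieldType) (S : comAlgType k) (I : idealr S)
  (u : kquot I) : S := repr (u : {ideal_quot I}).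

Record is_poisson (k : fieldType) (A : comAlgType k) (br : A -> A -> A) :
  Prop := IsPoisson {
  br_linearl : forall b, linear (br^~ b);
  br_linearr : forall a, linear (br a);
  br_alternating : forall a, br a a = 0;
  br_jacobi : forall a b c, br a (br b c) + br b (br c a) + br c (br a b) = 0;
  br_leibniz : forall a b c, br a (b * c) = br a b * c + b * br a c
}.

(* A comAlgType is unital and nonzero. *)
Record poissonAlg (k : fieldType) := PoissonAlg {
  poisson_sort :> comAlgType k;
  pbr : poisson_sort -> poisson_sort -> poisson_sort;
  pbrP : is_poisson pbr
}.

Definition derivation (k : fieldType) (A : comAlgType k) (d : A -> A) : Prop :=
  linear d /\ forall a b, d (a * b) = d a * b + a * d b.

Definition poisson_derivation (k : fieldType) (A : poissonAlg k) (d : A -> A) :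
  Prop :=
  derivation d /\ forall a b, d (pbr a b) = pbr (d a) b + pbr a (d b).

Definition poisson_central (k : fieldType) (A : poissonAlg k) (a : A) : Prop :=
  forall b, pbr a b = 0.

Definition poisson_morphism (k : fieldType) (A B : poissonAlg k)
  (phi : {lrmorphism A -> B}) : Prop :=
  forall u v, phi (pbr u v) = pbr (phi u) (phi v).

Definition poisson_isomorphic (k : fieldType) (A B : poissonAlg k) : Prop :=
  exists phi : {lrmorphism A -> B}, poisson_morphism phi /\ bijective phi.

Definition poisson_ideal (k : fieldType) (A : poissonAlg k) (I : idealr A) :
  Prop := forall a x, x \in I -> pbr a x \in I.

Definition poisson_subalgebra (k : fieldType) (A : poissonAlg k)
  (B : {pred A}) : Prop :=
  GRing.subalg_closed B /\ {in B &, forall u v, pbr u v \in B}.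

Section PoissonQuotient.
Variables (k : fieldType) (A : poissonAlg k) (I : idealr A).
Hypothesis hI : poisson_ideal I.

Definition quot_br (u v : kquot I) : kquot I := kpi I (pbr (krepr u) (krepr v)).

Let kreprK (u : kquot I) : kpi I (krepr u) = u.
Proof. exact: reprK. Qed.

Let kpi_eq (x y : A) : x - y \in I -> kpi I x = kpi I y.
Proof. by move=> xy; apply/eqP; rewrite -(Quotient.idealrBE I). Qed.

Let krepr_kpi (x : A) : krepr (kpi I x) - x \in I.
Proof. by rewrite (Quotient.idealrBE I); apply/eqP; exact: kreprK. Qed.

Let kpiD (x y : A) : kpi I (x + y) = kpi I x + kpi I y.
Proof. exact: rmorphD. Qed.

Let kpiM (x y : A) : kpi I (x * y) = kpi I x * kpi I y.
Proof. exact: rmorphM. Qed.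

Let kpiZ c (x : A) : kpi I (c *: x) = c *: kpi I x.
Proof. by rewrite -mulr_algl kpiM. Qed.

Let kpi0 : kpi I 0 = 0. Proof. exact: rmorph0. Qed.

Let pbrC (x y : A) : pbr x y = - pbr y x.
Proof.
have [brl brr alt _ _] := pbrP A.
have pbrDl (a b c : A) : pbr (a + b) c = pbr a c + pbr b c.
  by have := brl c 1 a b; rewrite !scale1r.
have pbrDr (a b c : A) : pbr c (a + b) = pbr c a + pbr c b.
  by have := brr c 1 a b; rewrite !scale1r.
apply/eqP; rewrite -addr_eq0; have := alt (x + y).
by rewrite pbrDl !pbrDr !alt addr0 add0r => ->.
Qed.

Let pbrB (x y z : A) : pbr z (x - y) = pbr z x - pbr z y.
Proof.
have [_ brr _ _ _] := pbrP A.
by rewrite addrC -scaleN1r brr scaleN1r addrC.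
Qed.

Fact quot_brE (x y : A) : quot_br (kpi I x) (kpi I y) = kpi I (pbr x y).
Proof.
apply: kpi_eq.
rewrite -(subrKA (pbr (krepr (kpi I x)) y)) rpredD //.
  by rewrite -pbrB hI.
by rewrite (pbrC _ y) (pbrC x) -opprD rpredN -pbrB hI.
Qed.

Fact quot_brP : is_poisson quot_br.
Proof.
have [brl brr alt jac lei] := pbrP A.
split=> [w c u v|u c v w|u|u v w|u v w]; rewrite -[u]kreprK.
- rewrite -[v]kreprK -[w]kreprK /=.
  by rewrite -kpiZ -kpiD !quot_brE brl kpiD kpiZ.
- rewrite -[v]kreprK -[w]kreprK.
  by rewrite -kpiZ -kpiD !quot_brE brr kpiD kpiZ.
- by rewrite quot_brE alt kpi0.
- by rewrite -[v]kreprK -[w]kreprK !quot_brE -!kpiD jac kpi0.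
- by rewrite -[v]kreprK -[w]kreprK -kpiM !quot_brE lei kpiD !kpiM.
Qed.

Definition poisson_quot : poissonAlg k := PoissonAlg quot_brP.

End PoissonQuotient.

Definition ore_derivation (k : fieldType) (S : poissonAlg k)
  (d delta : S -> S) : Prop :=
  derivation delta /\
  forall a b, delta (pbr a b) =
    pbr (delta a) b + pbr a (delta b) - d a * delta b + delta a * d b.

Definition ore_bracket (k : fieldType) (S : poissonAlg k) (d delta : S -> S)
  (br : kpoly S -> kpoly S -> kpoly S) : Prop :=
  (forall r s : S, br r%:P s%:P = (pbr r s)%:P) /\
  (forall r : S, br r%:P 'X = (d r)%:P * 'X + (delta r)%:P).

Inductive iterated_ore (k : fieldType) (R : poissonAlg k) :
  poissonAlg k -> Prop :=
| IteratedOreNil : iterated_ore R R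
| IteratedOreCons (S : poissonAlg k) (d delta : S -> S)
    (br : kpoly S -> kpoly S -> kpoly S) (brP : is_poisson br) :
    iterated_ore R S -> poisson_derivation d -> ore_derivation d delta ->
    ore_bracket d delta br -> iterated_ore R (PoissonAlg brP).

(* The generalized Weyl ring R[x_1, y_1, ..., x_n, y_n] / (y_i x_i - a_i). *)
Section GWRing.
Variables (k : fieldType) (R : comAlgType k) (n : nat) (a : 'I_n -> R).

Let P : comAlgType k := kmpoly R (n + n).

(* Of the n + n variables, the first n are the x_i and the last n the y_i. *)
Let X (i : 'I_n) : P := 'X_(lshift n i).
Let Y (i : 'I_n) : P := 'X_(rshift n i).

Definition gw_ideal : P -> bool := fun f =>
  boolp.asbool (exists c : 'I_n -> P, f = \sum_i c i * (Y i * X i - (a i)%:MP)).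

Fact gw_ideal_closed : idealr_closed gw_ideal.
Proof.
split=> [||b f g].
- apply/boolp.asboolP; exists (fun=> 0).
  by rewrite big1 // => i _; rewrite mul0r.
- apply/negP => /boolp.asboolP[c c1].
  pose v (j : 'I_(n + n)) := match split j with inl _ => 1 | inr i => a i end.
  have v_rel i : (Y i * X i - (a i)%:MP).@[v] = 0.
    rewrite mevalB mevalM !mevalXU mevalC /v.
    by rewrite (unsplitK (inl i)) (unsplitK (inr i)) mulr1 subrr.
  have := congr1 (meval v) c1.
  rewrite -mpolyC1 mevalC rmorph_sum big1 => [/eqP|i _]; first by rewrite oner_eq0.
  by rewrite /= mevalM v_rel mulr0.
move=> /boolp.asboolP[cf ->] /boolp.asboolP[cg ->].
apply/boolp.asboolP; exists (fun i => b * cf i + cg i).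
rewrite mulr_sumr -big_split; apply: eq_bigr => i _ /=.
by rewrite mulrDl mulrA.
Qed.

HB.instance Definition _ := isIdealr.Build P gw_ideal gw_ideal_closed.

Definition gw_ring : comAlgType k := kquot gw_ideal.

Definition gwC (r : R) : gw_ring := kpi gw_ideal r%:MP.
Definition gwx (i : 'I_n) : gw_ring := kpi gw_ideal (X i).
Definition gwy (i : 'I_n) : gw_ring := kpi gw_ideal (Y i).

End GWRing.

Arguments gwC {k R n} a r.
Arguments gwx {k R n} a i.
Arguments gwy {k R n} a i.

Record tgwpa_datum (k : fieldType) (R : poissonAlg k) (n : nat)
  (d : 'I_n -> R -> R) (a : 'I_n -> R) (mu gamma : 'I_n -> 'I_n -> k) :
  Prop := TgwpaDatum {
  tgwpa_der : forall i, poisson_derivation (d i);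
  tgwpa_derC : forall i j r, d i (d j r) = d j (d i r);
  tgwpa_central : forall i, poisson_central (a i);
  tgwpa_regular : forall i, GRing.lreg (a i);
  tgwpa_eigen : forall i j, i != j -> d j (a i) = gamma i j *: a i;
  tgwpa_compat : forall i j, i != j ->
    gamma i j + gamma j i = mu i j + mu j i
}.

Record tgwpa_bracket (k : fieldType) (R : poissonAlg k) (n : nat)
  (d : 'I_n -> R -> R) (a : 'I_n -> R) (mu gamma : 'I_n -> 'I_n -> k)
  (br : gw_ring a -> gw_ring a -> gw_ring a) : Prop := TgwpaBracket {
  tgwpa_br_base : forall r s, br (gwC a r) (gwC a s) = gwC a (pbr r s);
  tgwpa_br_rx : forall i r, br (gwC a r) (gwx a i) = gwC a (d i r) * gwx a i;
  tgwpa_br_ry : forall i r,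
    br (gwC a r) (gwy a i) = - (gwC a (d i r) * gwy a i);
  tgwpa_br_yx : forall i, br (gwy a i) (gwx a i) = gwC a (d i (a i));
  tgwpa_br_yx_neq : forall i j, i != j ->
    br (gwy a i) (gwx a j) = mu i j *: (gwx a j * gwy a i);
  tgwpa_br_xx : forall i j, i != j ->
    br (gwx a i) (gwx a j) = (gamma i j - mu i j) *: (gwx a i * gwx a j);
  tgwpa_br_yy : forall i j, i != j ->
    br (gwy a i) (gwy a j) = (mu j i - gamma i j) *: (gwy a i * gwy a j)
}.

Arguments tgwpa_bracket {k R n} d a mu gamma br.

(* The Laurent polynomial ring in t_1, ..., t_n over R is presented as
   R[t_1, u_1, ..., t_n, u_n] / (u_i t_i - 1), so that u_i is the inverse of t_i;
   [laurT R i] is t_i and [laurV R i] is u_i. *)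
Definition laurent_ring (k : fieldType) (R : comAlgType k) (n : nat) :
  comAlgType k := gw_ring (fun _ : 'I_n => 1 : R).

Definition laurC (k : fieldType) (R : comAlgType k) (n : nat) (r : R) :
  laurent_ring R n := gwC (fun=> 1) r.
Definition laurT (k : fieldType) (R : comAlgType k) (n : nat) (i : 'I_n) :
  laurent_ring R n := gwx (fun=> 1) i.
Definition laurV (k : fieldType) (R : comAlgType k) (n : nat) (i : 'I_n) :
  laurent_ring R n := gwy (fun=> 1) i.

Arguments laurC {k R} n r.
Arguments laurT {k} R {n} i.
Arguments laurV {k} R {n} i.

Record skew_laurent_bracket (k : fieldType) (R : poissonAlg k) (n : nat)
  (d : 'I_n -> R -> R) (p : 'M[k]_n)
  (br : laurent_ring R n -> laurent_ring R n -> laurent_ring R n) : Prop :=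
  SkewLaurentBracket {
  slp_br_base : forall r s, br (laurC n r) (laurC n s) = laurC n (pbr r s);
  slp_br_rt : forall i r, br (laurC n r) (laurT R i) = laurC n (d i r) * laurT R i;
  slp_br_rtV : forall i r, br (laurC n r) (laurV R i) = - (laurC n (d i r) * laurV R i);
  slp_br_tt : forall i j, i != j ->
    br (laurT R i) (laurT R j) = p i j *: (laurT R i * laurT R j);
  slp_br_ttV : forall i j, i != j ->
    br (laurT R i) (laurV R j) = - (p i j *: (laurT R i * laurV R j))
}.

(* Main.v *)
Require Import Defs.
From HB Require Import structures.
From mathcomp Require Import all_boot all_algebra ring_quotient.
From mathcomp Require Import mpoly ring.
From mathcomp Require boolp.

Set Implicit Arguments.
Unset Strict Implicit.
Unset Printing Implicit Defensive.

Import GRing.Theory.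
Local Open Scope ring_scope.
Local Open Scope quotient_scope.

(** Both statements go through a Poisson algebra S obtained from R by adjoining
    x_1, y_1, ..., x_n, y_n one at a time. Adjoining x_j uses a derivation that
    extends d_j and rescales the earlier generators, with delta = 0; adjoining
    y_j uses such an extension of - d_j, with delta = - {y_j, x_j} d/dx_j. Since
    S is generated by R and the x_i, y_i, every identity between derivations,
    biderivations or morphisms on S is checked on generators.

    (1) S maps onto A, and A is the quotient of S by the kernel.

    (2) For a = 1 and brackets of the form p_ij x_i x_j, each y_i x_i - 1 is
    Poisson central in S, so the bracket of S descends to the Laurent ring. The
    map A -> L sends x_i to t_i and y_i to a_i t_i^-1. It is injective: modulo
    the relations a monomial m reduces to prod_i a_i ^ min(m_{x_i}, m_{y_i})
    times a monomial without any factor x_i y_i. This reduction commutes with the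
    rescaling y_i -> a_i y_i, which multiplies coefficients by regular elements,
    and with a = 1 it kills the relations of L. *)

(** * Generating sets and derivations along a morphism *)

(** Encoded as an induction principle. Sums and products suffice because every [G] used below
    contains the image of a base ring, hence the scalars and -1. *)
Definition generated (A : comNzRingType) (G : A -> Prop) : Prop :=
  forall P : A -> Prop, (forall x, G x -> P x) ->
    (forall x y, P x -> P y -> P (x + y)) ->
    (forall x y, P x -> P y -> P (x * y)) -> forall x, P x.

(** Two nested inductions; symmetry of [Q] turns closure in the second argument into closure in the
    first. *)
Lemma generated2 (A : comNzRingType) (G : A -> Prop) (Q : A -> A -> Prop) :
  generated G -> (forall u v, Q u v -> Q v u) ->
  (forall u v w, Q u v -> Q u w -> Q u (v + w)) ->
  (forall u v w, Q u v -> Q u w -> Q u (v * w)) ->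
  (forall u v, G u -> G v -> Q u v) -> forall u v, Q u v.
Proof.
move=> genG Qsym QD QM QG u v; apply: (Qsym); move: u.
apply: (genG) => [u Gu|x y|x y]; [|exact: QD|exact: QM].
apply: (Qsym); move: v; apply: (genG) => [v|x y|x y]; [|exact: QD|exact: QM].
by move=> Gv; exact: QG.
Qed.

Lemma lrmorphism_of (k : fieldType) (A B : comAlgType k) (f : A -> B) :
  linear f -> (forall x y, f (x * y) = f x * f y) -> f 1 = 1 ->
  exists g : {lrmorphism A -> B}, g =1 f.
Proof.
move=> f_lin f_mul f_one.
pose lin := GRing.isLinear.Build k A B *:%R f f_lin.
pose mon := GRing.isMonoidMorphism.Build A B f (f_one, f_mul).
pose g : {lrmorphism A -> B} :=
  HB.pack f lin mon.
by exists g.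
Qed.

Lemma rmorphism_lrmorphism (k : fieldType) (A B : comAlgType k)
    (f : {rmorphism A -> B}) :
  (forall c : k, f c%:A = c%:A) -> exists g : {lrmorphism A -> B}, g =1 f.
Proof.
move=> f_alg; apply: lrmorphism_of; [|exact: rmorphM|exact: rmorph1].
by move=> c x y; rewrite rmorphD -mulr_algl rmorphM f_alg mulr_algl.
Qed.

(** For a morphism [f], a derivation of [A] into the module [B] over [A]. For the identity it
    unfolds to [derivation], so the lemmas below serve both notions. *)
Definition der_along (k : fieldType) (A B : comAlgType k) (f e : A -> B) :
  Prop := linear e /\ forall x y, e (x * y) = e x * f y + f x * e y.

Section DerAlong.
Variables (k : fieldType) (A B : comAlgType k) (f e : A -> B).
Hypothesis der : der_along f e.

Lemma der_alongD x y : e (x + y) = e x + e y.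
Proof. by have := der.1 1 x y; rewrite !scale1r. Qed.

Lemma der_along0 : e 0 = 0.
Proof. by apply: (addrI (e 0)); rewrite -der_alongD !addr0. Qed.

Lemma der_alongZ c x : e (c *: x) = c *: e x.
Proof. by have := der.1 c x 0; rewrite der_along0 !addr0. Qed.

Lemma der_alongN x : e (- x) = - e x.
Proof. by rewrite -scaleN1r der_alongZ scaleN1r. Qed.

Lemma der_alongB x y : e (x - y) = e x - e y.
Proof. by rewrite der_alongD der_alongN. Qed.

Lemma der_along1 : f 1 = 1 -> e 1 = 0.
Proof.
move=> f1; apply: (addrI (e 1)); rewrite addr0.
by rewrite -[in RHS](mulr1 1) der.2 f1 mulr1 mul1r.
Qed.

End DerAlong.

Lemma der_along_eq (k : fieldType) (A B : comAlgType k) (f e e' : A -> B)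
    (G : A -> Prop) :
  der_along f e -> der_along f e' -> generated G ->
  (forall x, G x -> e x = e' x) -> e =1 e'.
Proof.
move=> der der' genG eG; apply: genG => // x y ex ey.
  by rewrite (der_alongD der) (der_alongD der') ex ey.
by rewrite der.2 der'.2 ex ey.
Qed.

Lemma der_alongI (k : fieldType) (A B : comAlgType k)
    (f : {lrmorphism A -> B}) (e : A -> B) :
  (forall x y, e (x + y) = e x + e y) ->
  (forall x y, e (x * y) = e x * f y + f x * e y) ->
  (forall c : k, e c%:A = 0) -> der_along f e.
Proof.
move=> eD eM eA; split=> // c x y.
by rewrite eD -mulr_algl eM eA mul0r add0r rmorph_alg mulr_algl.
Qed.

(** The commutator of two derivations is a derivation, so it vanishes once it does on generators. *)
Lemma derivation_comm (k : fieldType) (A : comAlgType k) (e e' : A -> A)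
    (G : A -> Prop) :
  derivation e -> derivation e' -> generated G ->
  (forall x, G x -> e (e' x) = e' (e x)) -> forall x, e (e' x) = e' (e x).
Proof.
move=> der der' genG eG; apply: genG => // x y ex ey.
  by rewrite (der_alongD der') !(der_alongD der) (der_alongD der') ex ey.
rewrite der'.2 der.2 (der_alongD der) (der_alongD der') !der.2 !der'.2 ex ey.
by ring.
Qed.

(** * Bracket calculus and identities checked on generators *)

Section Bracket.
Variables (k : fieldType) (A : poissonAlg k).
Implicit Types (c : k) (x y z : A).

Lemma pbr_der x : derivation (pbr x).
Proof. by have [_ lin _ _ lei] := pbrP A; split; [apply: lin|apply: lei]. Qed.

Lemma pbrDr x y z : pbr x (y + z) = pbr x y + pbr x z.
Proof. exact: der_alongD (pbr_der x) _ _. Qed.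

Lemma pbrDl x y z : pbr (y + z) x = pbr y x + pbr z x.
Proof.
by have [lin _ _ _ _] := pbrP A; have := lin x 1 y z; rewrite !scale1r.
Qed.

Lemma pbrxx x : pbr x x = 0.
Proof. exact: br_alternating (pbrP A) _. Qed.

Lemma pbrC x y : pbr x y = - pbr y x.
Proof.
apply/eqP; rewrite -addr_eq0; have := pbrxx (x + y).
by rewrite pbrDl !pbrDr !pbrxx addr0 add0r => ->.
Qed.

Lemma pbrMr x y z : pbr x (y * z) = pbr x y * z + y * pbr x z.
Proof. exact: (pbr_der x).2. Qed.

Lemma pbrMl x y z : pbr (y * z) x = pbr y x * z + y * pbr z x.
Proof. by rewrite pbrC pbrMr opprD (pbrC y) (pbrC z) mulNr mulrN. Qed.

Lemma pbrZr c x y : pbr x (c *: y) = c *: pbr x y.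
Proof. exact: der_alongZ (pbr_der x) _ _. Qed.

Lemma pbrZl c x y : pbr (c *: y) x = c *: pbr y x.
Proof. by rewrite pbrC pbrZr (pbrC x) scalerN opprK. Qed.

Lemma pbrNr x y : pbr x (- y) = - pbr x y.
Proof. exact: der_alongN (pbr_der x) _. Qed.

Lemma pbr0r x : pbr x 0 = 0.
Proof. exact: der_along0 (pbr_der x). Qed.

Lemma pbr1r x : pbr x 1 = 0.
Proof. exact: der_along1 (pbr_der x) erefl. Qed.

Lemma pbr1l x : pbr 1 x = 0.
Proof. by rewrite pbrC pbr1r oppr0. Qed.

End Bracket.

Section GeneratorChecks.
Variables (k : fieldType) (A : poissonAlg k) (G : A -> Prop).
Hypothesis genG : generated G.

Lemma pbr_der_sym (e : A -> A) x y : derivation e ->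
  e (pbr x y) = pbr (e x) y + pbr x (e y) ->
  e (pbr y x) = pbr (e y) x + pbr y (e x).
Proof.
move=> der exy; rewrite (pbrC y x) (der_alongN der) exy.
by rewrite (pbrC (e y)) (pbrC y (e x)) opprD addrC.
Qed.

(** The defect [e {x, y} - {e x, y} - {x, e y}] is a skew biderivation. *)
Lemma poisson_derivation_generated (e : A -> A) :
  derivation e ->
  (forall x y, G x -> G y -> e (pbr x y) = pbr (e x) y + pbr x (e y)) ->
  poisson_derivation e.
Proof.
move=> der eG; split=> //; apply: (generated2 genG) => // x y.
- exact: pbr_der_sym.
- move=> z exy exz.
  by rewrite (der_alongD der) !pbrDr !(der_alongD der) exy exz; ring.
move=> z exy exz.
by rewrite der.2 !pbrMr (der_alongD der) !der.2 pbrDr !pbrMr exy exz; ring.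
Qed.

Lemma ore_der_sym (d e : A -> A) x y : derivation e ->
  e (pbr x y) = pbr (e x) y + pbr x (e y) - d x * e y + e x * d y ->
  e (pbr y x) = pbr (e y) x + pbr y (e x) - d y * e x + e y * d x.
Proof.
move=> der exy; rewrite (pbrC y x) (der_alongN der) exy.
by rewrite (pbrC (e y)) (pbrC y (e x)); ring.
Qed.

(** The additional term [d x * e y - e x * d y] of the defect is itself a skew biderivation. *)
Lemma ore_derivation_generated (d e : A -> A) :
  derivation d -> derivation e ->
  (forall x y, G x -> G y ->
     e (pbr x y) = pbr (e x) y + pbr x (e y) - d x * e y + e x * d y) ->
  ore_derivation d e.
Proof.
move=> derd der eG; split=> //; apply: (generated2 genG) => // x y.
- exact: ore_der_sym.
- move=> z exy exz.
  by rewrite !pbrDr !(der_alongD der) !(der_alongD derd) pbrDr exy exz; ring.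
move=> z exy exz.
by rewrite !pbrMr (der_alongD der) !der.2 derd.2 pbrDr !pbrMr exy exz; ring.
Qed.

Lemma pbr_morph_sym (B : poissonAlg k) (f : {lrmorphism A -> B}) x y :
  f (pbr x y) = pbr (f x) (f y) -> f (pbr y x) = pbr (f y) (f x).
Proof. by move=> fxy; rewrite (pbrC y x) rmorphN /= fxy -pbrC. Qed.

Lemma poisson_morphism_generated (B : poissonAlg k)
    (f : {lrmorphism A -> B}) :
  (forall x y, G x -> G y -> f (pbr x y) = pbr (f x) (f y)) ->
  poisson_morphism f.
Proof.
move=> fG; apply: (generated2 genG) => // x y.
- exact: pbr_morph_sym.
- by move=> z fxy fxz; rewrite pbrDr !rmorphD /= pbrDr fxy fxz.
by move=> z fxy fxz; rewrite pbrMr rmorphD !rmorphM /= pbrMr fxy fxz.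
Qed.

End GeneratorChecks.

(** * Derivations of a polynomial ring in one variable *)

Section PolyDerivation.
Variables (k : fieldType) (S : comAlgType k).

Definition kpolyC (s : S) : kpoly S := s%:P.
Definition kpolyX : kpoly S := 'X.

Lemma kpolyC_linear : linear kpolyC.
Proof. by move=> c x y; rewrite /kpolyC polyCD -mulr_algl polyCM. Qed.

Lemma kpolyC_mul x y : kpolyC (x * y) = kpolyC x * kpolyC y.
Proof. exact: polyCM. Qed.

HB.instance Definition _ :=
  GRing.isLinear.Build k S (kpoly S) *:%R kpolyC kpolyC_linear.
HB.instance Definition _ :=
  GRing.isMonoidMorphism.Build S (kpoly S) kpolyC (erefl, kpolyC_mul).

Definition poly_gens (p : kpoly S) : Prop :=
  (exists s, p = kpolyC s) \/ p = kpolyX.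

Lemma kpoly_generated : generated poly_gens.
Proof.
move=> P Pgen PD PM; elim/poly_ind => [|p c Pp].
  by apply: Pgen; left; exists 0; rewrite raddf0.
by apply: PD; [apply: PM => //|]; apply: Pgen; [right|left; exists c].
Qed.

Variables (e : S -> kpoly S) (v : kpoly S).
Hypothesis der : der_along kpolyC e.

(* The derivation of S[X] that restricts to e on S and sends X to v. *)
Definition poly_der (p : kpoly S) : kpoly S :=
  \sum_(i < size (p : {poly S})) e (p : {poly S})`_i * kpolyX ^+ i
  + (p : {poly S})^`() * v.

(** Since [e 0 = 0], the sum may run past the size, which gives polynomials of different sizes a
    common range. *)
Let poly_der_sum (p : kpoly S) m : (size (p : {poly S}) <= m)%N ->
  \sum_(i < size (p : {poly S})) e (p : {poly S})`_i * kpolyX ^+ i =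
  \sum_(i < m) e (p : {poly S})`_i * kpolyX ^+ i.
Proof.
move=> lepm.
rewrite (big_ord_widen m (fun i => e (p : {poly S})`_i * kpolyX ^+ i)) //.
rewrite big_mkcond; apply: eq_bigr => i _; case: ltnP => // pi.
by rewrite nth_default // (der_along0 der) mul0r.
Qed.

Let poly_derD p q : poly_der (p + q) = poly_der p + poly_der q.
Proof.
pose m := maxn (size (p : {poly S})) (size (q : {poly S})).
have lepm : (size (p : {poly S}) <= m)%N by rewrite leq_maxl.
have leqm : (size (q : {poly S}) <= m)%N by rewrite leq_maxr.
have lepqm : (size (p + q : {poly S})%R <= m)%N by apply: size_polyD.
rewrite /poly_der (poly_der_sum lepm) (poly_der_sum leqm) (poly_der_sum lepqm).
rewrite derivD [X in _ + X]mulrDl addrACA -big_split; congr (_ + _).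
by apply: eq_bigr => i _; rewrite coefD (der_alongD der) mulrDl.
Qed.

Lemma poly_derC s : poly_der (kpolyC s) = e s.
Proof.
rewrite /poly_der (@poly_der_sum _ 1) ?size_polyC_leq1 //.
by rewrite big_ord1 coefC mulr1 derivC mul0r addr0.
Qed.

Lemma poly_derX : poly_der kpolyX = v.
Proof.
rewrite /poly_der size_polyX !big_ord_recl big_ord0 !coefX /= derivX mul1r.
by rewrite (der_along0 der) (der_along1 der erefl) !mul0r !add0r.
Qed.

Let poly_derMC s p :
  poly_der (kpolyC s * p) = e s * p + kpolyC s * poly_der p.
Proof.
have le_sp : (size (kpolyC s * p : {poly S})%R <= size (p : {poly S}))%N.
  by rewrite /kpolyC mul_polyC size_scale_leq.
rewrite /poly_der (poly_der_sum le_sp).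
rewrite mulrDr addrA /kpolyC derivM derivC mul0r add0r mulrA; congr (_ + _).
rewrite [X in e s * X](_ : p = \sum_(i < size (p : {poly S}))
  kpolyC (p : {poly S})`_i * kpolyX ^+ i); last first.
  by rewrite -[LHS]coefK poly_def; apply: eq_bigr => i _; rewrite -mul_polyC.
rewrite !mulr_sumr -big_split; apply: eq_bigr => i _.
by rewrite coefCM der.2 mulrDl -!mulrA.
Qed.

Let poly_derMX p : poly_der (p * kpolyX) = poly_der p * kpolyX + p * v.
Proof.
rewrite /poly_der (@poly_der_sum _ (size (p : {poly S})).+1); last first.
  by apply: leq_trans (size_polyMleq _ _) _; rewrite size_polyX addn2.
rewrite big_ord_recl coefMX (der_along0 der) mul0r add0r.
rewrite derivM derivX mulr1 !mulrDl mulr_suml -!addrA; congr (_ + _).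
  by apply: eq_bigr => i _; rewrite coefMX exprSr mulrA.
by rewrite /kpolyX; ring.
Qed.

Lemma poly_der_derivation : derivation poly_der.
Proof.
apply: (@der_alongI _ _ _ idfun) => // [p q|c]; last first.
  by rewrite -[c%:A]/(kpolyC c%:A * 1) mulr1 poly_derC
    (der_alongZ der) (der_along1 der erefl) scaler0.
move: p q.
(* The Leibniz rule is proved for all [q] by induction on the left factor: a constant, the variable,
   a sum, a product. *)
apply: kpoly_generated => /= [_ [[s ->]| ->] q|x y Hx Hy q|x y Hx Hy q].
- by rewrite poly_derMC poly_derC.
- by rewrite mulrC poly_derMX poly_derX; ring.
- by rewrite mulrDl !poly_derD Hx Hy; ring.
by rewrite -mulrA !Hx Hy; ring.
Qed.

End PolyDerivation.

(** Shaped after the Leibniz rule: if a bracket is a derivation in its second argument, this carries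
    the derivation property in the first argument through products in the second. Coefficients 0, 1
    and -1 cover sums and signs. *)
Lemma der_along_comb (k : fieldType) (A B : comAlgType k) (f e1 e2 e : A -> B)
    (u v : B) :
  der_along f e1 -> der_along f e2 -> (forall x, e x = e1 x * u + v * e2 x) ->
  der_along f e.
Proof.
move=> der1 der2 eE; split=> [c x y|x y]; rewrite !eE.
  rewrite der1.1 der2.1 scalerDr mulrDl mulrDr -scalerAl -scalerAr.
  by rewrite addrACA.
by rewrite der1.2 der2.2; ring.
Qed.

(** * Biderivations that are Poisson brackets *)

Section PoissonGenerated.
Variables (k : fieldType) (A : comAlgType k) (br : A -> A -> A) (G : A -> Prop).
Hypotheses (derr : forall x, derivation (br x))
  (derl : forall y, derivation (br^~ y)) (genG : generated G).
Hypotheses (altG : forall x, G x -> br x x = 0)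
  (skewG : forall x y, G x -> G y -> br x y = - br y x).

Let brDr x y z : br x (y + z) = br x y + br x z.
Proof. exact: der_alongD (derr x) _ _. Qed.

Let brDl x y z : br (y + z) x = br y x + br z x.
Proof. exact: der_alongD (derl x) _ _. Qed.

Let brMr x y z : br x (y * z) = br x y * z + y * br x z.
Proof. exact: (derr x).2. Qed.

Let brMl x y z : br (y * z) x = br y x * z + y * br z x.
Proof. exact: (derl x).2. Qed.

Let skew x y : br x y = - br y x.
Proof.
move: x y; apply: (generated2 genG) => // x y.
- by move->; rewrite opprK.
- by move=> z xy xz; rewrite brDr brDl xy xz opprD.
by move=> z xy xz; rewrite brMr brMl xy xz; ring.
Qed.

Let alt x : br x x = 0.
Proof.
move: x; apply: genG => // x y x0 y0; have xy := skew x y.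
  by rewrite brDr !brDl x0 y0 xy; ring.
by rewrite brMr !brMl x0 y0 xy; ring.
Qed.

Let jac x y z := br x (br y z) + br y (br z x) + br z (br x y).

Let jac_cyc x y z : jac x y z = jac z x y.
Proof. by rewrite /jac addrC addrA. Qed.

Let jacD x y z w : jac x y (z + w) = jac x y z + jac x y w.
Proof. by rewrite /jac !(brDr, brDl); ring. Qed.

(** The mixed products of two brackets cancel by skewness, so the Jacobiator is a derivation in its
    last argument. *)
Let jacM x y z w : jac x y (z * w) = jac x y z * w + z * jac x y w.
Proof.
rewrite /jac !(brMr, brMl, brDr) (skew x z) (skew w x); ring.
Qed.

Lemma is_poisson_generated :
  (forall x y z, G x -> G y -> G z -> jac x y z = 0) -> is_poisson br.
Proof.
move=> jacG.
split=> //; [by move=> y; case: (derl y)|by move=> x; case: (derr x)|].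
(* One pass frees the last argument from [G], while [P] records what is still assumed of the other
   two. Cyclic symmetry then brings the next argument into last place; three passes free all of
   them. *)
have jac_gen P : (forall z, G z -> forall x y, P x y -> jac x y z = 0) ->
    forall z x y, P x y -> jac x y z = 0.
  move=> PG; apply: genG => [//|z w Hz Hw x y Pxy|z w Hz Hw x y Pxy].
    by rewrite jacD Hz // Hw // addr0.
  by rewrite jacM Hz // Hw // mul0r mulr0 addr0.
have jac1 z x y : G x /\ G y -> jac x y z = 0.
  by move: z x y; apply: jac_gen => z Gz x y [Gx Gy]; apply: jacG.
have jac2 z x y : G x -> jac x y z = 0.
  move: z x y; apply: (jac_gen (fun x _ => G x)) => z Gz x y Gx.
  by rewrite jac_cyc jac1.
move=> x y z; move: z x y.
have := jac_gen (fun _ _ => True) => jac3 z x y; apply: jac3 => // w Gw u v _.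
by rewrite jac_cyc jac2.
Qed.

End PoissonGenerated.

(** * Poisson Ore extensions *)

Section OreExtension.
Variables (k : fieldType) (S : poissonAlg k) (d delta : S -> S).
Hypotheses (hd : poisson_derivation d) (hdelta : ore_derivation d delta).

Let C : S -> kpoly S := @kpolyC k S.
Let X : kpoly S := kpolyX S.

Let lin (s : S) : kpoly S := C (d s) * X + C (delta s).
Let ad (s : S) : kpoly S -> kpoly S :=
  poly_der (fun u => C (pbr s u)) (lin s).
Let dlt : kpoly S -> kpoly S := poly_der lin 0.

(* [ad s] is {s, -} and [dlt] is {-, X}; the bracket is the derivation in the
   second argument prescribed by {f, s} = - {s, f} and {f, X}. *)
Definition ore_br (f : kpoly S) : kpoly S -> kpoly S :=
  poly_der (fun s => - ad s f) (dlt f).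

Let CD s t : C (s + t) = C s + C t. Proof. exact: raddfD. Qed.
Let CM s t : C (s * t) = C s * C t. Proof. exact: rmorphM. Qed.
Let C0 : C 0 = 0. Proof. exact: raddf0. Qed.
Let CN s : C (- s) = - C s. Proof. exact: raddfN. Qed.

Let der_C (e : S -> S) : derivation e -> der_along C (C \o e).
Proof.
move=> der; split=> [c x y|x y] /=; first by rewrite der.1; apply: linearP.
by rewrite der.2 CD !CM.
Qed.

Let der_lin : der_along C lin.
Proof.
apply: (@der_along_comb _ _ _ _ (C \o d) (C \o delta) _ X 1).
- exact: der_C hd.1.
- exact: der_C hdelta.1.
by move=> x; rewrite mul1r.
Qed.

Let ad_der s : derivation (ad s).
Proof. exact: poly_der_derivation (der_C (pbr_der s)). Qed.

Let dlt_der : derivation dlt.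
Proof. exact: poly_der_derivation. Qed.

Let adC s u : ad s (C u) = C (pbr s u).
Proof. exact: (poly_derC _ (der_C (pbr_der s))). Qed.

Let adX s : ad s X = lin s.
Proof. exact: (poly_derX _ (der_C (pbr_der s))). Qed.

(** The construction makes [ad s] a derivation in its argument; the same property in [s] needs an
    induction on [f]. *)
Let ad_derl f : der_along C (ad^~ f).
Proof.
move: f; apply: kpoly_generated => [_ [[u ->]| ->]|f g Hf Hg|f g Hf Hg].
- apply: (@der_along_comb _ _ _ _ (C \o pbr u) (C \o pbr u) _ (-1) 0).
  + exact: der_C (pbr_der u).
  + exact: der_C (pbr_der u).
  by move=> x; rewrite mul0r addr0 adC pbrC CN mulrN1.
- apply: (der_along_comb (u := 1) (v := 0) der_lin der_lin) => x.
  by rewrite mul0r addr0 adX mulr1.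
- apply: (der_along_comb (u := 1) (v := 1) Hf Hg) => x.
  by rewrite (der_alongD (ad_der x)) mul1r mulr1.
by apply: (der_along_comb (u := g) (v := f) Hf Hg) => x; rewrite (ad_der x).2.
Qed.

Let adN_der f : der_along C (fun s => - ad s f).
Proof.
apply: (der_along_comb (u := -1) (v := 0) (ad_derl f) (ad_derl f)) => x.
by rewrite mulrN1 mul0r addr0.
Qed.

Let ore_br_der f : derivation (ore_br f).
Proof. exact: poly_der_derivation. Qed.

Let ore_brC f s : ore_br f (C s) = - ad s f.
Proof. exact: (poly_derC _ (adN_der f)). Qed.

Let ore_brX f : ore_br f X = dlt f.
Proof. exact: (poly_derX _ (adN_der f)). Qed.

Let dltC s : dlt (C s) = lin s.
Proof. exact: (poly_derC _ der_lin). Qed.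

Let dltX : dlt X = 0.
Proof. exact: (poly_derX _ der_lin). Qed.

Let ore_br_derl g : derivation (ore_br^~ g).
Proof.
move: g; apply: kpoly_generated => [_ [[u ->]| ->]|f g Hf Hg|f g Hf Hg].
- apply: (der_along_comb (u := -1) (v := 0) (ad_der u) (ad_der u)) => x.
  by rewrite ore_brC mulrN1 mul0r addr0.
- apply: (der_along_comb (u := 1) (v := 0) dlt_der dlt_der) => x.
  by rewrite mul0r addr0 ore_brX mulr1.
- apply: (der_along_comb (u := 1) (v := 1) Hf Hg) => x.
  by rewrite (der_alongD (ore_br_der x)) mul1r mulr1.
apply: (der_along_comb (u := g) (v := f) Hf Hg) => x.
by rewrite (ore_br_der x).2.
Qed.

Let ore_brCC s t : ore_br (C s) (C t) = C (pbr s t).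
Proof. by rewrite ore_brC adC -CN -pbrC. Qed.

Let ore_brCX s : ore_br (C s) X = lin s.
Proof. by rewrite ore_brX dltC. Qed.

Let ore_brXC s : ore_br X (C s) = - lin s.
Proof. by rewrite ore_brC adX. Qed.

Let ore_brXX : ore_br X X = 0.
Proof. by rewrite ore_brX dltX. Qed.

Let jac x y z := ore_br x (ore_br y z) + ore_br y (ore_br z x) +
  ore_br z (ore_br x y).

Let jac_cyc x y z : jac x y z = jac z x y.
Proof. by rewrite /jac addrC addrA. Qed.

(** The one triple where the hypotheses on [d] and [delta] enter: the coefficient of [X] vanishes as
    [d] is a Poisson derivation, the constant term by the Ore condition on [delta]. *)
Let jacCCX s t : jac (C s) (C t) X = 0.
Proof.
have brNr f g : ore_br f (- g) = - ore_br f g.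
  exact: der_alongN (ore_br_der f) _.
have brDr f g h : ore_br f (g + h) = ore_br f g + ore_br f h.
  exact: der_alongD (ore_br_der f) _ _.
have brMr f g h : ore_br f (g * h) = ore_br f g * h + g * ore_br f h.
  exact: (ore_br_der f).2.
rewrite /jac ore_brCC ore_brCX !ore_brXC brNr /lin !brDr !brMr.
rewrite !ore_brCC !ore_brCX.
rewrite hd.2 hdelta.2 /lin !CD CN !CM (pbrC t) (pbrC t (delta s)) !CN.
by ring.
Qed.

Lemma ore_br_poisson : is_poisson ore_br.
Proof.
apply: (@is_poisson_generated _ _ _ (@poly_gens k S)) => //.
- exact: kpoly_generated.
- by move=> _ [[s ->]| ->]; rewrite ?ore_brXX // ore_brCC pbrxx C0.
- move=> _ _ [[s ->]| ->] [[t ->]| ->]; rewrite ?ore_brXX ?oppr0 //.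
  + by rewrite !ore_brCC -CN -pbrC.
  + by rewrite ore_brCX ore_brXC opprK.
  by rewrite ore_brCX ore_brXC.
(* The two nested terms cancel once [{f, X} = - {X, f}] is known for every [f], not only for
   generators. *)
have jacXX f : jac X X f = 0.
  have skew : ore_br f X = - ore_br X f.
    move: f; apply: kpoly_generated => [_ [[s ->]| ->]|f g Hf Hg|f g Hf Hg].
    - by rewrite ore_brCX ore_brXC opprK.
    - by rewrite ore_brXX oppr0.
    - rewrite (der_alongD (ore_br_derl X)) (der_alongD (ore_br_der X)) Hf Hg.
      by ring.
    by rewrite (ore_br_der X).2 (ore_br_derl X).2 Hf Hg; ring.
  rewrite /jac skew (der_alongN (ore_br_der X)) subrr add0r ore_brXX.
  exact: der_along0 (ore_br_der f).
(* Up to cyclic permutation there are three kinds of triples: no [X], one [X], at least two [X]. *)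
move=> _ _ _ [[s ->]| ->] [[t ->]| ->] [[u ->]| ->].
- rewrite !ore_brCC -!CD.
  by rewrite (br_jacobi (pbrP S)) C0.
- exact: jacCCX.
- by rewrite -/(jac _ _ _) jac_cyc; exact: jacCCX.
- by rewrite -/(jac _ _ _) jac_cyc jac_cyc; exact: jacXX.
- by rewrite -/(jac _ _ _) jac_cyc jac_cyc; exact: jacCCX.
- by rewrite -/(jac _ _ _) jac_cyc; exact: jacXX.
- exact: jacXX.
exact: jacXX.
Qed.

Lemma ore_br_ore : ore_bracket d delta ore_br.
Proof. by split=> [r s|r]; [exact: ore_brCC|exact: ore_brCX]. Qed.

End OreExtension.

(** An interface that hides the polynomial ring: the bracket, generation, the universal property,
    and extension of derivations with a free value on [X]. *)
Record is_ore_extension (k : fieldType) (S : poissonAlg k) (d delta : S -> S)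
    (S' : poissonAlg k) (C : {lrmorphism S -> S'}) (X : S') : Prop := {
  ore_ext_iterated : forall R, iterated_ore R S -> iterated_ore R S';
  ore_ext_morph : poisson_morphism C;
  ore_ext_brX : forall s, pbr (C s) X = C (d s) * X + C (delta s);
  ore_ext_gen : generated (fun x : S' => (exists s, x = C s) \/ x = X);
  ore_ext_hom : forall (T : comAlgType k) (f : {lrmorphism S -> T}) (t : T),
    exists g : {lrmorphism S' -> T}, (forall s, g (C s) = f s) /\ g X = t;
  ore_ext_der : forall (e : S -> S) (w : S'), derivation e ->
    exists D : S' -> S',
      [/\ derivation D, forall s, D (C s) = C (e s) & D X = w]
}.

Lemma ore_extension_exists (k : fieldType) (S : poissonAlg k)
    (d delta : S -> S) :
  poisson_derivation d -> ore_derivation d delta ->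
  exists (S' : poissonAlg k) (C : {lrmorphism S -> S'}) (X : S'),
    is_ore_extension d delta C X.
Proof.
move=> hd hdelta; pose brP := ore_br_poisson hd hdelta.
have orebr := ore_br_ore hd hdelta.
pose C : {lrmorphism S -> kpoly S} := @kpolyC k S.
exists (PoissonAlg brP), C, (kpolyX S); split.
- move=> R RS; exact: (IteratedOreCons brP RS hd hdelta orebr).
- by move=> s t; rewrite /pbr /=; rewrite orebr.1.
- exact: orebr.2.
- exact: kpoly_generated.
- move=> T f t; pose cft : commr_rmorph f t := fun s => mulrC _ _.
  pose g0 : {rmorphism kpoly S -> T} := horner_morph cft.
  have [|g gE] := @rmorphism_lrmorphism _ _ _ g0.
    move=> c; rewrite -[c%:A]/(kpolyC c%:A * 1) mulr1.
    rewrite -[LHS]/(horner_morph cft (c%:A)%:P) horner_morphC.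
    exact: rmorph_alg.
  exists g; split=> [s|]; rewrite gE; first exact: horner_morphC.
  exact: horner_morphX.
move=> e w der.
have derC : der_along (@kpolyC k S) (@kpolyC k S \o e).
  split=> [c x y|x y] /=; first by rewrite der.1; apply: linearP.
  by rewrite der.2 rmorphD !rmorphM.
exists (poly_der (@kpolyC k S \o e) w); split.
- exact: poly_der_derivation.
- exact: poly_derC.
exact: poly_derX.
Qed.

(** * Adjoining the pairs x_j, y_j *)

Section Tower.
Variables (k : fieldType) (R : poissonAlg k) (n : nat) (d : 'I_n -> R -> R).
Variables (b : 'I_n -> R) (q : bool -> bool -> 'I_n -> 'I_n -> k).
Hypotheses (d_der : forall i, poisson_derivation (d i))
  (dC : forall i j r, d i (d j r) = d j (d i r))
  (b_central : forall i, poisson_central (b i))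
  (q_skew : forall s t (i j : 'I_n), i != j -> q s t i j = - q t s j i)
  (d_b : forall (c : bool) (i j : 'I_n), i != j ->
    (-1) ^+ c *: d i (b j) = (q false c j i + q true c j i) *: b j).
Variables (T : comAlgType k) (f : {lrmorphism R -> T}) (z : bool -> 'I_n -> T).

(* [Z false i] is x_i and [Z true i] is y_i; b i is their bracket {y_i, x_i}. *)
Definition tower_gens (m : nat) (S : poissonAlg k) (iota : R -> S)
    (Z : bool -> 'I_n -> S) (x : S) : Prop :=
  (exists r, x = iota r) \/ (exists c (i : 'I_n), (i < m)%N /\ x = Z c i).

(** [tower_der] supplies the derivations needed to adjoin the next pair; [tower_hom] yields the map
    onto [A] in (1) and onto the Laurent ring in (2). Values of [Z] at indices from [m] on are
    unconstrained. *)
Record tower (m : nat) (S : poissonAlg k) (iota : {lrmorphism R -> S})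
    (Z : bool -> 'I_n -> S) : Prop := {
  tower_ore : iterated_ore R S;
  tower_base : poisson_morphism iota;
  tower_rz : forall (c : bool) (i : 'I_n) r, (i < m)%N ->
    pbr (iota r) (Z c i) = (-1) ^+ c *: (iota (d i r) * Z c i);
  tower_zz : forall s t (i j : 'I_n), (i < m)%N -> (j < m)%N -> i != j ->
    pbr (Z s i) (Z t j) = q s t i j *: (Z s i * Z t j);
  tower_yx : forall i : 'I_n, (i < m)%N ->
    pbr (Z true i) (Z false i) = iota (b i);
  tower_gen : generated (tower_gens m iota Z);
  tower_hom : exists phi : {lrmorphism S -> T},
    (forall r, phi (iota r) = f r) /\
    forall c (i : 'I_n), (i < m)%N -> phi (Z c i) = z c i;
  tower_der : forall (e : R -> R) (l : bool -> 'I_n -> k), derivation e ->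
    exists D : S -> S, [/\ derivation D, forall r, D (iota r) = iota (e r) &
      forall c (i : 'I_n), (i < m)%N -> D (Z c i) = l c i *: Z c i]
}.

Lemma tower0 : exists (S : poissonAlg k) (iota : {lrmorphism R -> S})
  (Z : bool -> 'I_n -> S), tower 0 iota Z.
Proof.
exists R, idfun, (fun _ _ => 0); split=> //.
- exact: IteratedOreNil.
- by move=> P PG _ _ x; apply: PG; left; exists x.
- by exists f.
by move=> e l der; exists e.
Qed.

Section Step.
Variables (j : 'I_n) (S : poissonAlg k) (iota : {lrmorphism R -> S}).
Variables (Z : bool -> 'I_n -> S).
Hypothesis tow : tower j iota Z.

Let lt_neq (i : 'I_n) : (i < j)%N -> i != j.
Proof. by move=> ij; rewrite -val_eqE /= ltn_eqF. Qed.

(** The [D] for which [{s, Z c j} = D s * Z c j] reproduces the prescribed brackets of the new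
    generator with [R] and the earlier pairs. *)
Definition twist_der (c : bool) (D : S -> S) : Prop :=
  [/\ derivation D, forall r, D (iota r) = iota ((-1) ^+ c *: d j r) &
    forall c' (i : 'I_n), (i < j)%N -> D (Z c' i) = q c' c i j *: Z c' i].

Lemma twist_der_exists c : exists D, twist_der c D.
Proof.
apply: (tower_der tow (e := fun r => (-1) ^+ c *: d j r)
  (fun c' i => q c' c i j)).
have der := (d_der j).1.
split=> [a x y|x y]; last by rewrite der.2 scalerDr scalerAl scalerAr.
by rewrite der.1 scalerDr !scalerA mulrC.
Qed.

(** The check on [{y_i, x_i} = b_i] compares the action of [D] on [b_i] with the sum of its weights
    on [x_i] and [y_i]; this is [d_b]. *)
Lemma twist_der_poisson c D : twist_der c D -> poisson_derivation D.
Proof.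
move=> [der Dr DZ]; apply: (poisson_derivation_generated (tower_gen tow)) => //.
have DrZ r c' (i : 'I_n) : (i < j)%N -> D (pbr (iota r) (Z c' i)) =
    pbr (D (iota r)) (Z c' i) + pbr (iota r) (D (Z c' i)).
  move=> ij; rewrite (tower_rz tow) // Dr DZ // pbrZr !(tower_rz tow) //.
  rewrite (der_alongZ der) der.2 Dr DZ // dC scalerDr (der_alongZ (d_der i).1).
  by rewrite -scalerAr !scalerA (mulrC (q _ _ _ _)).
have Dyx (i : 'I_n) : (i < j)%N -> D (pbr (Z true i) (Z false i)) =
    pbr (D (Z true i)) (Z false i) + pbr (Z true i) (D (Z false i)).
  move=> ij; rewrite !DZ // pbrZr pbrZl !(tower_yx tow) // Dr d_b ?lt_neq //.
    by rewrite linearZ /= -scalerDl addrC.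
  by rewrite eq_sym lt_neq.
move=> _ _ [[r ->]|[s [i [ij ->]]]] [[r' ->]|[t [i' [i'j ->]]]].
- rewrite -(tower_base tow) !Dr -!(tower_base tow) -rmorphD (d_der j).2.
  by rewrite pbrZl pbrZr -scalerDr.
- exact: DrZ.
- by apply: pbr_der_sym => //; exact: DrZ.
have [ii'|ii'] := eqVneq i i'; last first.
  rewrite !DZ // pbrZl pbrZr !(tower_zz tow) // (der_alongZ der) der.2 !DZ //.
  by rewrite -scalerAl -scalerAr !scalerDr !scalerA !(mulrC (q s t i i')).
rewrite -{i' i'j}ii'; case: s t => [] [].
- by rewrite DZ // pbrZl pbrZr pbrxx scaler0 (der_along0 der) addr0.
- exact: Dyx.
- by apply: pbr_der_sym => //; exact: Dyx.
by rewrite DZ // pbrZl pbrZr pbrxx scaler0 (der_along0 der) addr0.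
Qed.

Lemma twist_der_comm c c' D D' : twist_der c D -> twist_der c' D' ->
  forall x, D (D' x) = D' (D x).
Proof.
move=> [der Dr DZ] [der' Dr' DZ'].
apply: (derivation_comm der der' (tower_gen tow)).
move=> _ [[r ->]|[s [i [ij ->]]]].
  by rewrite Dr Dr' Dr Dr' !(der_alongZ (d_der j).1) !scalerA mulrC.
rewrite DZ // DZ' // (der_alongZ der) (der_alongZ der') DZ // DZ' //.
by rewrite !scalerA mulrC.
Qed.

(** This is the Ore condition for adjoining [y_j] after [x_j]. On [R] both sides vanish, as [b j] is
    central and [D], [D'] restrict to opposite derivations; on [Z s i] it is [d_b] with [q_skew]. *)
Lemma twist_der_b D D' : twist_der false D -> twist_der true D' ->
  forall x, pbr (iota (b j)) x = - (D x + D' x) * iota (b j).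
Proof.
move=> [der Dr DZ] [der' Dr' DZ'].
apply: (der_along_eq (pbr_der _) _ (tower_gen tow)).
  apply: (der_along_comb (u := - iota (b j)) (v := - iota (b j)) der der') => x.
  by ring.
move=> _ [[r ->]|[s [i [ij ->]]]].
  rewrite -(tower_base tow) b_central Dr Dr' expr0 expr1 scaleN1r scale1r.
  by rewrite rmorphN subrr oppr0 mul0r rmorph0.
rewrite (tower_rz tow) // DZ // DZ' // scalerAl -linearZ /= d_b ?lt_neq //.
rewrite linearZ /= -scalerDl -scaleNr -!scalerAl mulrC; congr (_ *: _).
by rewrite !(q_skew _ _ (lt_neq ij)) opprD !opprK.
Qed.

Lemma towerS : exists (S' : poissonAlg k) (iota' : {lrmorphism R -> S'})
  (Z' : bool -> 'I_n -> S'), tower j.+1 iota' Z'.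
Proof.
have [D0 tD0] := twist_der_exists false; have [D1 tD1] := twist_der_exists true.
have pD0 := twist_der_poisson tD0; have pD1 := twist_der_poisson tD1.
have DC := twist_der_comm tD1 tD0.
have bD := twist_der_b tD0 tD1.
have der0 : derivation (fun _ : S => 0 : S).
  by split=> [c x y|x y]; rewrite ?scaler0 ?mulr0 ?mul0r addr0.
have ore0 : ore_derivation D0 (fun=> 0).
  by split=> // x y; rewrite pbr0r pbrC pbr0r; ring.
have [S1 [C1 [X1 ext1]]] := ore_extension_exists pD0 ore0.
(* [E] and [dlt] are chosen so that [{x_j, y_j} = E x_j * y_j + dlt x_j] equals [- b_j]: hence 0
   here and [- b_j] below. *)
have [E [derE EC EX]] := ore_ext_der ext1 0 pD1.1.
have [dlt [derd dltC dX]] := ore_ext_der ext1 (- C1 (iota (b j))) der0.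
have brCX s : pbr (C1 s) X1 = C1 (D0 s) * X1.
  by rewrite (ore_ext_brX ext1) rmorph0 addr0.
have brCC s t : pbr (C1 s) (C1 t) = C1 (pbr s t).
  by rewrite (ore_ext_morph ext1).
have pE : poisson_derivation E.
  have ECX s : E (pbr (C1 s) X1) = pbr (E (C1 s)) X1 + pbr (C1 s) (E X1).
    by rewrite brCX derE.2 EX EC EC pbr0r mulr0 !addr0 brCX DC.
  apply: (poisson_derivation_generated (ore_ext_gen ext1)) => //.
  move=> _ _ [[s ->]| ->] [[t ->]| ->].
  - by rewrite brCC !EC pD1.2 rmorphD /= !brCC.
  - exact: ECX.
  - by apply: pbr_der_sym => //; exact: ECX.
  by rewrite pbrxx EX pbr0r (pbrC 0) pbr0r (der_along0 derE) oppr0 addr0.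
have oredlt : ore_derivation E dlt.
  have dCX s : dlt (pbr (C1 s) X1) = pbr (dlt (C1 s)) X1 +
      pbr (C1 s) (dlt X1) - E (C1 s) * dlt X1 + dlt (C1 s) * E X1.
    rewrite brCX derd.2 !dltC dX EC rmorph0 (pbrC 0) pbr0r pbrNr brCC.
    by rewrite (pbrC s) bD !(rmorphN, rmorphM, rmorphD); ring.
  apply: (ore_derivation_generated (ore_ext_gen ext1)) => //.
  move=> _ _ [[s ->]| ->] [[t ->]| ->].
  - by rewrite brCC !dltC rmorph0 pbr0r (pbrC 0) pbr0r; ring.
  - exact: dCX.
  - by apply: ore_der_sym => //; exact: dCX.
  rewrite pbrxx (der_along0 derd) EX (pbrC (dlt X1)); ring.
have [S2 [C2 [X2 ext2]]] := ore_extension_exists pE oredlt.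
have br2CC s t : pbr (C2 s) (C2 t) = C2 (pbr s t).
  by rewrite (ore_ext_morph ext2).
have br2X s : pbr (C2 (C1 s)) X2 = C2 (C1 (D1 s)) * X2.
  by rewrite (ore_ext_brX ext2) EC dltC !rmorph0 addr0.
pose Y (c : bool) := if c then X2 else C2 X1.
have brY (c : bool) s : pbr (C2 (C1 s)) (Y c) =
    C2 (C1 ((if c then D1 else D0) s)) * Y c.
  by case: c; rewrite /Y ?br2X // br2CC brCX rmorphM.
(* Above [j] these values are arbitrary; only indices up to [j] are constrained. *)
pose Z' c i := if i == j then Y c else C2 (C1 (Z c i)).
have Zj c : Z' c j = Y c by rewrite /Z' eqxx.
have Zi c (i : 'I_n) : (i < j)%N -> Z' c i = C2 (C1 (Z c i)).
  by move=> ij; rewrite /Z' (negPf (lt_neq ij)).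
have ltS (i : 'I_n) : (i < j.+1)%N -> i = j \/ (i < j)%N.
  by rewrite ltnS leq_eqVlt => /orP[/eqP/val_inj|]; [left|right].
pose iota' : {lrmorphism R -> S2} := C2 \o (C1 \o iota).
have [_ D0r D0Z] := tD0; have [_ D1r D1Z] := tD1.
exists S2, iota', Z'; split.
- exact: (ore_ext_iterated ext2 (ore_ext_iterated ext1 (tower_ore tow))).
- by move=> r s; rewrite /= (tower_base tow) -brCC -br2CC.
- move=> c i r /ltS[->|ij].
    rewrite Zj brY; case: c; rewrite /= ?D0r ?D1r /= ?expr0 ?expr1 ?scale1r //.
    by rewrite !scaleN1r !rmorphN mulNr.
  by rewrite Zi // br2CC brCC (tower_rz tow) // !linearZ /= !rmorphM.
- have Zij s t (i : 'I_n) : (i < j)%N ->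
      pbr (Z' s i) (Z' t j) = q s t i j *: (Z' s i * Z' t j).
    move=> ij; rewrite Zj Zi // brY.
    by case: t; rewrite ?D0Z ?D1Z // !linearZ /= scalerAl.
  move=> s t i i' /ltS[->|ij] /ltS[->|i'j]; rewrite ?eqxx // => ii'.
  + by rewrite pbrC Zij // (q_skew s t ii') scaleNr (mulrC (Z' s j)).
  + exact: Zij.
  by rewrite !Zi // br2CC brCC (tower_zz tow) // !linearZ /= !rmorphM.
- move=> i /ltS[->|ij]; last by rewrite !Zi // br2CC brCC (tower_yx tow).
  rewrite !Zj /Y pbrC (ore_ext_brX ext2) EX rmorph0 mul0r add0r dX rmorphN.
  by rewrite opprK.
- move=> P PG PD PM; apply: (ore_ext_gen ext2) => // _ [[s ->]| ->]; last first.
    by apply: PG; right; exists true, j; rewrite Zj.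
  move: s; apply: (ore_ext_gen ext1).
  + move=> _ [[s ->]| ->]; last first.
      by apply: PG; right; exists false, j; rewrite Zj.
    move: s; apply: (tower_gen tow).
    * move=> _ [[r ->]|[c [i [ij ->]]]]; first by apply: PG; left; exists r.
      by apply: PG; right; exists c, i; rewrite Zi // ltnS ltnW.
    * by move=> x y Px Py; rewrite !rmorphD; apply: PD.
    by move=> x y Px Py; rewrite !rmorphM; apply: PM.
  + by move=> x y Px Py; rewrite rmorphD; apply: PD.
  by move=> x y Px Py; rewrite rmorphM; apply: PM.
- have [phi [phir phiZ]] := tower_hom tow.
  have [phi1 [phi1C phi1X]] := ore_ext_hom ext1 phi (z false j).
  have [phi2 [phi2C phi2X]] := ore_ext_hom ext2 phi1 (z true j).
  exists phi2; split=> [r|c i /ltS[->|ij]]; first by rewrite /= phi2C phi1C.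
    by rewrite Zj; case: c; rewrite /Y ?phi2X // phi2C.
  by rewrite Zi // phi2C phi1C phiZ.
move=> e l dere; have [D [derD Dr DZ]] := tower_der tow l dere.
have [D' [derD' D'C D'X]] := ore_ext_der ext1 (l false j *: X1) derD.
have [D'' [derD'' D''C D''X]] := ore_ext_der ext2 (l true j *: X2) derD'.
exists D''; split=> // [r|c i /ltS[->|ij]].
- by rewrite /= D''C D'C Dr.
- by rewrite Zj; case: c; rewrite /Y ?D''X // D''C D'X linearZ.
by rewrite Zi // D''C D'C DZ // !linearZ.
Qed.

End Step.

Lemma tower_exists : exists (S : poissonAlg k) (iota : {lrmorphism R -> S})
  (Z : bool -> 'I_n -> S), tower n iota Z.
Proof.
suff tow m : (m <= n)%N -> exists (S : poissonAlg k)
    (iota : {lrmorphism R -> S}) (Z : bool -> 'I_n -> S), tower m iota Z.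
  exact: tow.
elim: m => [_|m IHm ltmn]; first exact: tower0.
have [S [iota [Z tow]]] := IHm (ltnW ltmn).
exact: (@towerS (Ordinal ltmn) S iota Z).
Qed.

End Tower.

(** * Quotients, transported brackets and the first isomorphism theorem *)

Section KQuot.
Variables (k : fieldType) (S : comAlgType k) (I : idealr S).

Lemma kpi_linear : linear (kpi I).
Proof.
move=> c x y; rewrite -mulr_algl /kpi rmorphD rmorphM.
by [].
Qed.

Lemma kpi_mul x y : kpi I (x * y) = kpi I x * kpi I y.
Proof. exact: rmorphM. Qed.

HB.instance Definition _ :=
  GRing.isLinear.Build k S (kquot I) *:%R (kpi I) kpi_linear.
HB.instance Definition _ :=
  GRing.isMonoidMorphism.Build S (kquot I) (kpi I) (rmorph1 _, kpi_mul).

Lemma kreprK (u : kquot I) : kpi I (krepr u) = u.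
Proof. exact: reprK. Qed.

Lemma kpi_eq0 x : (kpi I x == 0) = (x \in I).
Proof. by rewrite -[x in RHS]subr0 Quotient.idealrBE -(rmorph0 (kpi I)). Qed.

Lemma kquot_lift (T : comAlgType k) (f : {lrmorphism S -> T}) :
  (forall x, x \in I -> f x = 0) ->
  exists g : {lrmorphism kquot I -> T}, forall x, g (kpi I x) = f x.
Proof.
move=> fI.
have fE x : f (krepr (kpi I x)) = f x.
  apply/eqP; rewrite -subr_eq0 -rmorphB /= fI //.
  by rewrite -kpi_eq0 rmorphB /= kreprK subrr.
have [|||g gE] := @lrmorphism_of _ (kquot I) T (f \o @krepr k S I).
- move=> c u v; rewrite -[u]kreprK -[v]kreprK -linearP /= !fE.
  by rewrite linearP.
- by move=> u v; rewrite -[u]kreprK -[v]kreprK -rmorphM /= !fE rmorphM.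
- by rewrite -(rmorph1 (kpi I)) /= fE rmorph1.
by exists g => x; rewrite gE /= fE.
Qed.

End KQuot.

Section Surjection.
Variables (k : fieldType) (A : poissonAlg k) (B : comAlgType k).
Variable f : {lrmorphism A -> B}.

Definition lrker : A -> bool := fun x => f x == 0.

Fact lrker_closed : idealr_closed lrker.
Proof.
split=> [||c x y]; rewrite !unfold_in ?rmorph0 ?rmorph1 ?oner_eq0 //.
move=> /eqP fx /eqP fy.
by rewrite rmorphD rmorphM /= fx fy mulr0 addr0.
Qed.

HB.instance Definition _ := isIdealr.Build A lrker lrker_closed.

Hypothesis f_surj : forall y, exists x, f x = y.

Lemma section_exists : exists g : B -> A, cancel g f.
Proof. by have [g gE] := boolp.choice f_surj; exists g. Qed.

(** The bracket of [B] is computed on arbitrary preimages. Changing one preimage alters the result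
    by the image of a bracket with a kernel element, which is 0; skewness covers the first
    argument. *)
Lemma bracket_pushforward :
  (forall x y, f y = 0 -> f (pbr x y) = 0) ->
  exists br : B -> B -> B, is_poisson br /\
    forall x y, br (f x) (f y) = f (pbr x y).
Proof.
move=> f_ker; have [g gK] := section_exists.
have brE x y : f (pbr (g (f x)) (g (f y))) = f (pbr x y).
  have gf0 z : f (g (f z) - z) = 0 by rewrite rmorphB /= gK subrr.
  have := f_ker (g (f x)) _ (gf0 y).
  rewrite pbrDr pbrNr rmorphB /= => /eqP; rewrite subr_eq0 => /eqP ->.
  have := f_ker y _ (gf0 x).
  rewrite pbrDr pbrNr rmorphB /= => /eqP; rewrite subr_eq0 => /eqP eqy.
  by rewrite pbrC rmorphN /= eqy -rmorphN /= -pbrC.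
exists (fun u v => f (pbr (g u) (g v))); split=> //.
have [brl brr alt jac lei] := pbrP A.
split=> [w c u v|u c v w|u|u v w|u v w]; have [x <-] := f_surj u;
  try (have [y <-] := f_surj v; have [z <-] := f_surj w).
- by rewrite -linearP /= !brE brl linearP.
- by rewrite -linearP /= !brE brr linearP.
- by rewrite brE alt rmorph0.
- rewrite (brE y z) (brE z x) (brE x y) !brE -!rmorphD.
  by rewrite /= jac rmorph0.
by rewrite -rmorphM /= !brE lei rmorphD !rmorphM.
Qed.

End Surjection.

(** A set-theoretic section [g] of [f] becomes a morphism after [kpi], because [g (f x)] and [x]
    agree modulo the kernel. *)
Lemma poisson_first_isomorphism (k : fieldType) (A B : poissonAlg k)
    (f : {lrmorphism A -> B}) :
  poisson_morphism f -> (forall y, exists x, f x = y) ->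
  exists (I : idealr A) (hI : poisson_ideal I),
    poisson_isomorphic B (poisson_quot hI).
Proof.
move=> f_morph f_surj; have [g gK] := section_exists f_surj.
pose I : idealr A := lrker f.
have IE x : (x \in I) = (f x == 0) by [].
have hI : poisson_ideal I.
  by move=> x y; rewrite !IE f_morph => /eqP->; rewrite pbr0r.
exists I, hI.
have hE x : kpi I (g (f x)) = kpi I x.
  by apply/eqP; rewrite -subr_eq0 -rmorphB kpi_eq0 IE rmorphB /= gK subrr.
have [|||h hh] := @lrmorphism_of _ B (kquot I) (kpi I \o g).
- by move=> c u v; rewrite -[u]gK -[v]gK -linearP /= !hE linearP.
- by move=> u v; rewrite -[u]gK -[v]gK -rmorphM /= !hE rmorphM.
- by rewrite -(rmorph1 f) /= hE rmorph1.
exists h; split.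
  move=> u v; rewrite /= !hh /= -[u]gK -[v]gK -f_morph !hE.
  exact/esym/quot_brE.
exists (fun u => f (krepr (u : kquot I))) => [u|u].
  rewrite /= hh /=; apply/eqP; rewrite -subr_eq0 -{2}[u]gK -rmorphB -IE.
  by rewrite -kpi_eq0 rmorphB /= kreprK subrr.
by rewrite /= hh /= hE kreprK.
Qed.

Lemma kmpoly_generated (k : fieldType) (R : comAlgType k) (m : nat) :
  generated (fun p : kmpoly R m =>
    (exists r, p = r%:MP_[m]) \/ (exists l, p = 'X_l :> {mpoly R[m]})).
Proof.
move=> P Pgen PD PM p.
have PC r : P r%:MP_[m] by apply: Pgen; left; exists r.
elim/mpolyind: (p : {mpoly R[m]}) => [|c u q _ _ Pq].
  by rewrite -mpolyC0.
apply: PD => //; rewrite -mul_mpolyC; apply: (PM) => //.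
have P1 : P 1 by rewrite -[1]/(1%:MP_[m]).
rewrite mpolyXE_id; apply: (big_ind P) => [//|x y|l _]; first exact: PM.
elim: (u l) => [|e IHe]; first by rewrite expr0.
by rewrite exprS; apply: PM => //; apply: Pgen; right; exists l.
Qed.

(** * Generators and relations of the generalized Weyl ring *)

Section GWPresentation.
Variables (k : fieldType) (R : comAlgType k) (n : nat).

Definition gw_var (c : bool) (i : 'I_n) : kmpoly R (n + n) :=
  'X_(if c then rshift n i else lshift n i).

Lemma gw_var_generated : generated (fun p : kmpoly R (n + n) =>
  (exists r, p = r%:MP) \/ (exists c i, p = gw_var c i)).
Proof.
move=> P PG; apply: kmpoly_generated => p [[r ->]|[l ->]].
  by apply: PG; left; exists r.
apply: PG; right; rewrite -[l]splitK; case: (split l) => i /=.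
  by exists false, i.
by exists true, i.
Qed.

Lemma gw_hom (T : comAlgType k) (f : {lrmorphism R -> T})
    (z : bool -> 'I_n -> T) :
  exists g : {lrmorphism kmpoly R (n + n) -> T},
    (forall r, g r%:MP = f r) /\ forall c i, g (gw_var c i) = z c i.
Proof.
pose h (l : 'I_(n + n)) :=
  match split l with inl i => z false i | inr i => z true i end.
pose g0 : {rmorphism kmpoly R (n + n) -> T} := mmap f h.
have g0C r : g0 r%:MP = f r by exact: mmapC.
have [|g gE] := @rmorphism_lrmorphism _ _ _ g0.
  move=> c; rewrite -[c%:A]/((c%:A)%:MP_[n + n] * 1) mulr1 g0C.
  exact: rmorph_alg.
exists g; split=> [r|c i]; first by rewrite gE.
rewrite gE /gw_var -[LHS]/(mmap f h 'X_(if c then rshift n i else lshift n i)).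
rewrite mmapX mmap1U /h.
by case: c; [rewrite (unsplitK (inr i))|rewrite (unsplitK (inl i))].
Qed.

Variable a : 'I_n -> R.

Definition gwz (c : bool) (i : 'I_n) : gw_ring a :=
  if c then gwy a i else gwx a i.

Lemma gwzE c i : gwz c i = kpi (gw_ideal a) (gw_var c i).
Proof. by case: c. Qed.

Lemma gwz_mul i : gwz true i * gwz false i = gwC a (a i).
Proof.
apply/eqP; rewrite -subr_eq0 /gwC !gwzE -rmorphM -rmorphB /= kpi_eq0.
(* Kronecker coefficients select the relation of index [i]. *)
apply/boolp.asboolP; exists (fun j => (j == i)%:R).
rewrite (bigD1 i) //= eqxx mul1r big1 ?addr0 // => j /negPf ->.
by rewrite mul0r.
Qed.

Lemma gwC_linear : linear (gwC a).
Proof.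
move=> c x y; rewrite /gwC -linearP; congr (kpi _ _).
by rewrite mpolyCD -mulr_algl mpolyCM.
Qed.

Lemma gwC_mul x y : gwC a (x * y) = gwC a x * gwC a y.
Proof. by rewrite /gwC -rmorphM; congr (kpi _ _); rewrite mpolyCM. Qed.

HB.instance Definition _ :=
  GRing.isLinear.Build k R (gw_ring a) *:%R (gwC a) gwC_linear.
HB.instance Definition _ :=
  GRing.isMonoidMorphism.Build R (gw_ring a) (gwC a) (rmorph1 _, gwC_mul).

Definition gw_gens (x : gw_ring a) : Prop :=
  (exists r, x = gwC a r) \/ (exists c i, x = gwz c i).

Lemma gw_generated : generated gw_gens.
Proof.
move=> P PG PD PM x; rewrite -[x]kreprK; move: (krepr x).
apply: gw_var_generated.
- move=> _ [[r ->]|[c [i ->]]]; first by apply: PG; left; exists r.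
  by apply: PG; right; exists c, i; rewrite gwzE.
- by move=> u v Pu Pv; rewrite rmorphD; apply: PD.
by move=> u v Pu Pv; rewrite rmorphM; apply: PM.
Qed.

Lemma gw_ring_lift (T : comAlgType k) (f : {lrmorphism R -> T})
    (z : bool -> 'I_n -> T) :
  (forall i, z true i * z false i = f (a i)) ->
  exists g : {lrmorphism gw_ring a -> T},
    (forall r, g (gwC a r) = f r) /\ forall c i, g (gwz c i) = z c i.
Proof.
move=> zf; have [g [gC gX]] := gw_hom f z.
have [|h hE] := @kquot_lift _ _ (gw_ideal a) _ g.
  move=> _ /boolp.asboolP[c ->]; rewrite rmorph_sum big1 // => i _.
  rewrite rmorphM rmorphB rmorphM /= gC.
  rewrite (gX true i : g 'X_(rshift n i) = _).
  by rewrite (gX false i : g 'X_(lshift n i) = _) zf subrr mulr0.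
exists h; split=> [r|c i]; first by rewrite hE gC.
by rewrite gwzE hE gX.
Qed.

End GWPresentation.

(** * Linear maps prescribed on monomials *)

Section MonomialMap.
Variables (R : comNzRingType) (N : nat).
Implicit Types (p q : {mpoly R[N]}) (m : 'X_{1..N}).

Lemma mpoly_additive_eq (V : zmodType) (F G : {additive {mpoly R[N]} -> V}) :
  (forall c m, F (c *: 'X_[m]) = G (c *: 'X_[m])) -> F =1 G.
Proof.
move=> FG p; elim/mpolyind: p => [|c m p _ _ IHp]; first by rewrite !raddf0.
by rewrite !raddfD FG IHp.
Qed.

Definition monomial_map (h : 'X_{1..N} -> {mpoly R[N]}) p : {mpoly R[N]} :=
  \sum_(m <- msupp p) p@_m *: h m.

Variable h : 'X_{1..N} -> {mpoly R[N]}.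

Let monomial_mapE s p : uniq s -> {subset msupp p <= s} ->
  monomial_map h p = \sum_(m <- s) p@_m *: h m.
Proof.
move=> s_uniq ps; rewrite (bigID (mem (msupp p))) /= [X in _ + X]big1 ?addr0.
  rewrite -big_filter; apply: perm_big; apply: uniq_perm.
  - exact: msupp_uniq.
  - exact: filter_uniq.
  by move=> m; rewrite mem_filter /=; case: (boolP (m \in msupp p)) => // /ps.
by move=> m /memN_msupp_eq0->; rewrite scale0r.
Qed.

Fact monomial_map_additive : additive (monomial_map h).
Proof.
(* A common index set for the three sums; coefficients outside a support are 0. *)
move=> p q; pose s := undup (msupp p ++ msupp q ++ msupp (p - q)).
rewrite !(@monomial_mapE s) ?undup_uniq // -?sumrB.
- by apply: eq_bigr => m _; rewrite mcoeffB scalerBl.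
all: by move=> m ms; rewrite mem_undup !mem_cat ms ?orbT.
Qed.

HB.instance Definition _ := GRing.isAdditive.Build {mpoly R[N]} {mpoly R[N]}
  (monomial_map h) monomial_map_additive.

Lemma monomial_mapZX c m : monomial_map h (c *: 'X_[m]) = c *: h m.
Proof.
have [->|c0] := eqVneq c 0; first by rewrite !scale0r raddf0.
rewrite /monomial_map msuppMCX // big_seq1 mcoeffZ mcoeffX eqxx.
by rewrite mulr1.
Qed.

End MonomialMap.

(** * Normal forms of monomials *)

Section NormalForm.
Variables (R : comNzRingType) (n : nat).
Implicit Types (a : 'I_n -> R) (u : 'I_n -> nat) (m : 'X_{1..n + n}).

Definition xdeg m (i : 'I_n) : nat := m (lshift n i).
Definition ydeg m (i : 'I_n) : nat := m (rshift n i).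
Definition xydeg m i : nat := minn (xdeg m i) (ydeg m i).

Definition xymonom u : 'X_{1..n + n} :=
  [multinom u (match split l with inl i => i | inr i => i end) | l < n + n].
(** Division by the largest product of powers of the [x_i y_i]; the truncated subtraction is
    exact. *)
Definition reduced_monom m : 'X_{1..n + n} := (m - xymonom (xydeg m))%MM.

Definition apow a u : R := \prod_i a i ^+ u i.

Definition normal_form a : {mpoly R[n + n]} -> {mpoly R[n + n]} :=
  monomial_map (fun m => apow a (xydeg m) *: 'X_[reduced_monom m]).
(** The substitution [y_i -> a_i y_i], written as a diagonal map on monomials so that injectivity
    can be read off coefficients. *)
Definition rescale a : {mpoly R[n + n]} -> {mpoly R[n + n]} :=
  monomial_map (fun m => apow a (ydeg m) *: 'X_[m]).

HB.instance Definition _ a := GRing.Additive.on (normal_form a).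
HB.instance Definition _ a := GRing.Additive.on (rescale a).

Lemma xdeg_xymonom u i : xdeg (xymonom u) i = u i.
Proof. by rewrite /xdeg mnmE (unsplitK (inl i)). Qed.

Lemma ydeg_xymonom u i : ydeg (xymonom u) i = u i.
Proof. by rewrite /ydeg mnmE (unsplitK (inr i)). Qed.

Lemma multinom_xyP m m' : xdeg m =1 xdeg m' -> ydeg m =1 ydeg m' -> m = m'.
Proof.
move=> eqx eqy; apply/mnmP => l.
by case: (split_ordP l) => i ->; [exact: eqx|exact: eqy].
Qed.

Lemma xdegD m m' i : xdeg (m + m')%MM i = (xdeg m i + xdeg m' i)%N.
Proof. exact: mnmDE. Qed.
Lemma ydegD m m' i : ydeg (m + m')%MM i = (ydeg m i + ydeg m' i)%N.
Proof. exact: mnmDE. Qed.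
Lemma xdegB m m' i : xdeg (m - m')%MM i = (xdeg m i - xdeg m' i)%N.
Proof. exact: mnmBE. Qed.
Lemma ydegB m m' i : ydeg (m - m')%MM i = (ydeg m i - ydeg m' i)%N.
Proof. exact: mnmBE. Qed.

Lemma reduced_monomK m : (reduced_monom m + xymonom (xydeg m))%MM = m.
Proof.
apply: multinom_xyP => i.
  by rewrite xdegD xdegB xdeg_xymonom subnK // geq_minl.
by rewrite ydegD ydegB ydeg_xymonom subnK // geq_minr.
Qed.

Lemma xydegD_xymonom m u i : xydeg (m + xymonom u)%MM i = (xydeg m i + u i)%N.
Proof. by rewrite /xydeg xdegD ydegD xdeg_xymonom ydeg_xymonom addn_minl. Qed.

Lemma reduced_monomD_xymonom m u :
  reduced_monom (m + xymonom u)%MM = reduced_monom m.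
Proof.
apply: multinom_xyP => i; rewrite !(xdegB, ydegB, xdegD, ydegD).
  by rewrite !xdeg_xymonom xydegD_xymonom subnDr.
by rewrite !ydeg_xymonom xydegD_xymonom subnDr.
Qed.

Lemma xymonomE u : 'X_[xymonom u] =
  \prod_i ('X_(rshift n i) * 'X_(lshift n i)) ^+ u i :> {mpoly R[n + n]}.
Proof.
rewrite mpolyXE_id big_split_ord /= -big_split; apply: eq_bigr => i _ /=.
by rewrite -/(xdeg _ _) -/(ydeg _ _) xdeg_xymonom ydeg_xymonom exprMn mulrC.
Qed.

Lemma apow1 u : apow (fun=> 1) u = 1.
Proof. by rewrite /apow big1 // => i _; rewrite expr1n. Qed.

Lemma apow_lreg a u : (forall i, GRing.lreg (a i)) -> GRing.lreg (apow a u).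
Proof.
move=> a_reg; rewrite /apow; apply: (big_ind (@GRing.lreg R)).
- exact: lreg1.
- exact: lregM.
by move=> i _; apply: lregX.
Qed.

Lemma rescale_inj a p :
  (forall i, GRing.lreg (a i)) -> rescale a p = 0 -> p = 0.
Proof.
move=> a_reg p0; apply/mpolyP => m.
suff eqm : (rescale a p)@_m = p@_m * apow a (ydeg m).
  have := eqm; rewrite p0 !mcoeff0 mulrC => /esym pa0.
  have reg : injective ( *%R (apow a (ydeg m))) := @apow_lreg a _ a_reg.
  by apply: reg; rewrite pa0 mulr0.
elim/mpolyind: p {p0} => [|c u p _ _ IHp].
  by rewrite raddf0 mcoeff0 mul0r.
rewrite raddfD !mcoeffD IHp mulrDl; congr (_ + _).
rewrite /= /rescale monomial_mapZX !mcoeffZ !mcoeffX.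
by case: eqP => [->|_]; rewrite ?mulr1 ?mulr0 ?mul0r.
Qed.

(** On both sides [a_i] occurs with exponent [ydeg m i]: on the right it splits into the part
    removed by reduction and the [y]-degree that remains. *)
Lemma normal_form_rescale a p :
  normal_form (fun=> 1) (rescale a p) = rescale a (normal_form a p).
Proof.
move: p; apply: (@mpoly_additive_eq _ _ _
  (normal_form (fun=> 1) \o rescale a) (rescale a \o normal_form a)) => c m /=.
rewrite /rescale /normal_form !monomial_mapZX !scalerA !monomial_mapZX.
rewrite apow1 scale1r scalerA; congr (_ *: _); rewrite -mulrA; congr (_ * _).
rewrite /apow -big_split; apply: eq_bigr => i _ /=.
by rewrite -exprD ydegB ydeg_xymonom subnKC // geq_minr.
Qed.

(** With all [a_i] equal to 1, a monomial and its product with [x_i y_i] have the same normal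
    form. *)
Lemma normal_form1_rel p (i : 'I_n) :
  normal_form (fun=> 1) (p * ('X_(rshift n i) * 'X_(lshift n i) - 1%:MP)) = 0.
Proof.
elim/mpolyind: p => [|c m p _ _ IHp]; first by rewrite mul0r raddf0.
rewrite mulrDl raddfD /= IHp addr0 mulrBr mpolyC1 mulr1 raddfB /=.
have -> : 'X_(rshift n i) * 'X_(lshift n i) =
    'X_[xymonom (fun j => (j == i) : nat)] :> {mpoly R[n + n]}.
  rewrite xymonomE (bigD1 i) //= eqxx expr1 big1 ?mulr1 // => j /negPf->.
  by rewrite expr0.
rewrite -scalerAl -mpolyXD /normal_form !monomial_mapZX reduced_monomD_xymonom.
by rewrite !apow1 subrr.
Qed.

Section Evaluation.
Variables (T : comNzRingType) (a : 'I_n -> R).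
Variables F G : {rmorphism {mpoly R[n + n]} -> T}.

Lemma rmorph_normal_form p :
  (forall i, F ('X_(rshift n i) * 'X_(lshift n i)) = F (a i)%:MP) ->
  F (normal_form a p) = F p.
Proof.
move=> Fa; move: p.
apply: (@mpoly_additive_eq _ _ _ (F \o normal_form a) F) => c m /=.
rewrite /normal_form monomial_mapZX scalerA -[in RHS](reduced_monomK m) mpolyXD.
rewrite -!mul_mpolyC mpolyCM !rmorphM -mulrA; congr (_ * _).
rewrite mulrC; congr (_ * _).
rewrite /apow xymonomE !rmorph_prod; apply: eq_bigr => i _.
by rewrite !rmorphXn Fa.
Qed.

Lemma rmorph_rescale p : (forall r, G r%:MP = F r%:MP) ->
  (forall i, G 'X_(lshift n i) = F 'X_(lshift n i)) ->
  (forall i, G 'X_(rshift n i) = F (a i)%:MP * F 'X_(rshift n i)) ->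
  F (rescale a p) = G p.
Proof.
move=> GC Gx Gy; move: p.
apply: (@mpoly_additive_eq _ _ _ (F \o rescale a) G) => c m /=.
rewrite /rescale monomial_mapZX scalerA -!mul_mpolyC mpolyCM !rmorphM GC -mulrA.
congr (_ * _); rewrite /apow !mpolyXE_id !rmorph_prod !big_split_ord /=.
rewrite mulrCA -big_split /=.
congr (_ * _); apply: eq_bigr => i _; rewrite !rmorphXn ?Gx //.
by rewrite -exprMn -Gy.
Qed.

End Evaluation.

End NormalForm.

(** * Injectivity of the map into the Laurent ring *)

Section PresentationMap.
Variables (k : fieldType) (R : comAlgType k) (n : nat) (a : 'I_n -> R).

Definition kpi_mpoly : {rmorphism {mpoly R[n + n]} -> gw_ring a} :=
  kpi (gw_ideal a).

Lemma kpi_normal_form p : kpi_mpoly (normal_form a p) = kpi_mpoly p.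
Proof.
apply: rmorph_normal_form => i; rewrite rmorphM.
exact: gwz_mul.
Qed.

Lemma kpi_mpoly_eq0 p : kpi_mpoly p = 0 ->
  exists c : 'I_n -> {mpoly R[n + n]},
    p = \sum_i c i * ('X_(rshift n i) * 'X_(lshift n i) - (a i)%:MP).
Proof.
move=> p0.
have : kpi (gw_ideal a) (p : kmpoly R (n + n)) == 0 by apply/eqP.
by rewrite kpi_eq0 => /boolp.asboolP[c pc]; exists c.
Qed.

End PresentationMap.

Section LaurentEmbedding.
Variables (k : fieldType) (R : comAlgType k) (n : nat) (a : 'I_n -> R).

Let one : 'I_n -> R := fun=> 1.

Lemma kpi_rescale (g : {lrmorphism gw_ring a -> gw_ring one}) p :
  (forall r, g (gwC a r) = gwC one r) ->
  (forall i, g (gwx a i) = gwx one i) ->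
  (forall i, g (gwy a i) = gwC one (a i) * gwy one i) ->
  kpi_mpoly one (rescale a p) = g (kpi_mpoly a p).
Proof.
move=> gC gx gy.
apply: (@rmorph_rescale _ _ _ a (kpi_mpoly one) (g \o kpi_mpoly a)).
- exact: gC.
- exact: gx.
exact: gy.
Qed.

(** If [g] kills the class of [p], then [rescale a p] is a combination of the Laurent relations, so
    its normal form is 0. Commutation and injectivity of [rescale] give [normal_form a p = 0], and
    [p] has the same class as its normal form. *)
Lemma gw_ring_rescale_inj (g : {lrmorphism gw_ring a -> gw_ring one}) :
  (forall i, GRing.lreg (a i)) ->
  (forall r, g (gwC a r) = gwC one r) ->
  (forall i, g (gwx a i) = gwx one i) ->
  (forall i, g (gwy a i) = gwC one (a i) * gwy one i) ->
  injective g.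
Proof.
move=> a_reg gC gx gy; apply: raddf_inj => v.
have [p <-] : exists p, kpi_mpoly a p = v by exists (krepr v); exact: kreprK.
move=> gp0; have [|c pc] := @kpi_mpoly_eq0 _ _ _ one (rescale a p).
  by rewrite (kpi_rescale p gC gx gy).
have nf0 : rescale a (normal_form a p) = 0.
  rewrite -normal_form_rescale pc raddf_sum big1 // => i _.
  exact: normal_form1_rel.
have p0 := rescale_inj a_reg nf0.
rewrite -(kpi_normal_form a p) p0.
exact: rmorph0.
Qed.

End LaurentEmbedding.

(** * The bracket table shared by [S], [A] and the Laurent algebra *)

(** Only brackets are listed, not the products [y_i x_i], so the table also holds in [S], where
    these products are free. *)
Record weyl_relations (k : fieldType) (R : poissonAlg k) (n : nat)
    (d : 'I_n -> R -> R) (b : 'I_n -> R)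
    (q : bool -> bool -> 'I_n -> 'I_n -> k)
    (A : poissonAlg k) (iota : R -> A) (Z : bool -> 'I_n -> A) : Prop := {
  weyl_base : forall r s, pbr (iota r) (iota s) = iota (pbr r s);
  weyl_rz : forall (c : bool) i r,
    pbr (iota r) (Z c i) = (-1) ^+ c *: (iota (d i r) * Z c i);
  weyl_zz : forall s t (i j : 'I_n), i != j ->
    pbr (Z s i) (Z t j) = q s t i j *: (Z s i * Z t j);
  weyl_yx : forall i, pbr (Z true i) (Z false i) = iota (b i)
}.

Lemma weyl_morphism (k : fieldType) (R : poissonAlg k) (n : nat)
    (d : 'I_n -> R -> R) (b : 'I_n -> R)
    (q : bool -> bool -> 'I_n -> 'I_n -> k)
    (A B : poissonAlg k) (iA : R -> A) (ZA : bool -> 'I_n -> A)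
    (iB : R -> B) (ZB : bool -> 'I_n -> B) (g : {lrmorphism A -> B}) :
  weyl_relations d b q iA ZA -> weyl_relations d b q iB ZB ->
  generated (fun x => (exists r, x = iA r) \/ (exists c i, x = ZA c i)) ->
  (forall r, g (iA r) = iB r) -> (forall c i, g (ZA c i) = ZB c i) ->
  poisson_morphism g.
Proof.
move=> relA relB genA gi gZ; apply: (poisson_morphism_generated genA).
have grz r c i : g (pbr (iA r) (ZA c i)) = pbr (g (iA r)) (g (ZA c i)).
  by rewrite gi gZ (weyl_rz relA) (weyl_rz relB) linearZ rmorphM /= gi gZ.
have gyx i : g (pbr (ZA true i) (ZA false i)) =
    pbr (g (ZA true i)) (g (ZA false i)).
  by rewrite !gZ (weyl_yx relA) (weyl_yx relB).
move=> _ _ [[r ->]|[s [i ->]]] [[r' ->]|[t [j ->]]].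
- by rewrite !gi (weyl_base relA) (weyl_base relB).
- exact: grz.
- exact/pbr_morph_sym/grz.
have [<-|ij] := eqVneq i j; last first.
  by rewrite !gZ (weyl_zz relA) // (weyl_zz relB) // linearZ rmorphM /= !gZ.
case: s t => [] []; rewrite ?pbrxx ?rmorph0 //.
exact/pbr_morph_sym/gyx.
Qed.

Lemma tower_weyl (k : fieldType) (R : poissonAlg k) (n : nat)
    (d : 'I_n -> R -> R) (b : 'I_n -> R)
    (q : bool -> bool -> 'I_n -> 'I_n -> k) (T : comAlgType k)
    (f : {lrmorphism R -> T}) (z : bool -> 'I_n -> T)
    (S : poissonAlg k) (iota : {lrmorphism R -> S}) (Z : bool -> 'I_n -> S) :
  tower d b q f z n iota Z ->
  weyl_relations d b q iota Z /\
  generated (fun x => (exists r, x = iota r) \/ (exists c i, x = Z c i)).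
Proof.
move=> tow; split; [split|].
- by move=> r s; rewrite (tower_base tow).
- by move=> c i r; exact: (tower_rz tow).
- by move=> s t i j; exact: (tower_zz tow).
- by move=> i; exact: (tower_yx tow).
move=> P PG; apply: (tower_gen tow) => _ [[r ->]|[c [i [_ ->]]]]; apply: PG.
  by left; exists r.
by right; exists c, i.
Qed.

Lemma gw_ring_surj (k : fieldType) (R : comAlgType k) (n : nat) (a : 'I_n -> R)
    (S : comAlgType k) (g : {lrmorphism S -> gw_ring a}) :
  (forall r, exists s, g s = gwC a r) ->
  (forall c i, exists s, g s = gwz a c i) ->
  forall x, exists s, g s = x.
Proof.
move=> gC gZ; apply: gw_generated.
- by move=> _ [[r ->]|[c [i ->]]].
- by move=> x y [s <-] [t <-]; exists (s + t); rewrite rmorphD.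
by move=> x y [s <-] [t <-]; exists (s * t); rewrite rmorphM.
Qed.

(** * The skew Laurent Poisson algebra *)

Section SkewLaurent.
Variables (k : fieldType) (R : poissonAlg k) (n : nat) (d : 'I_n -> R -> R).
Variable p : 'I_n -> 'I_n -> k.
Hypotheses (d_der : forall i, poisson_derivation (d i))
  (dC : forall i j r, d i (d j r) = d j (d i r))
  (p_skew : forall i j, p i j = - p j i).

Let one : 'I_n -> R := fun=> 1.

(** Each inverse generator contributes one sign. *)
Definition laurent_q (s t : bool) (i j : 'I_n) : k := (-1) ^+ (s (+) t) * p i j.

(** The weights of [x_i] and [y_i] are opposite, so they cancel in the product. *)
Lemma laurent_casimir (S : poissonAlg k) (iota : {lrmorphism R -> S})
    (Z : bool -> 'I_n -> S) :
  weyl_relations d (fun=> 0) laurent_q iota Z ->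
  generated (fun x => (exists r, x = iota r) \/ (exists c i, x = Z c i)) ->
  forall i x, pbr x (Z true i * Z false i) = 0.
Proof.
move=> rel gen i.
have Zyx : pbr (Z true i) (Z false i) = 0 by rewrite (weyl_yx rel) rmorph0.
apply: gen => [_ [[r ->]|[s [j ->]]]|x y xi yi|x y xi yi].
- rewrite pbrMr !(weyl_rz rel) expr0 expr1 scaleN1r scale1r; ring.
- have [->|ji] := eqVneq j i.
    by case: s; rewrite pbrMr pbrxx ?(pbrC (Z false i)) Zyx; ring.
  rewrite pbrMr !(weyl_zz rel) // /laurent_q addbT addbF.
  rewrite -scalerAl -scalerAr mulrA (mulrC (Z true i) (Z s j)).
  rewrite -scalerDl -mulrDl.
  by case: s; rewrite expr0 expr1 ?addrN ?addNr mul0r scale0r.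
- by rewrite pbrDl xi yi addr0.
by rewrite pbrMl xi yi mul0r mulr0 addr0.
Qed.

Lemma skew_laurent_exists :
  exists (br : laurent_ring R n -> laurent_ring R n -> laurent_ring R n)
    (brP : is_poisson br),
    weyl_relations d (fun=> 0) laurent_q (A := PoissonAlg brP)
      (gwC one) (gwz one).
Proof.
have b_central (i : 'I_n) : poisson_central (0 : R).
  by move=> r; rewrite pbrC pbr0r oppr0.
have q_skew s t (i j : 'I_n) : i != j ->
    laurent_q s t i j = - laurent_q t s j i.
  by move=> _; rewrite /laurent_q p_skew addbC mulrN.
have d_b (c : bool) (i j : 'I_n) : i != j ->
    (-1) ^+ c *: d i 0 =
    (laurent_q false c j i + laurent_q true c j i) *: (0 : R).
  by rewrite (der_along0 (d_der i).1) !scaler0.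
have [S [iota [Z tow]]] := tower_exists d_der dC b_central q_skew d_b
  (gwC one) (gwz one).
have [rel gen] := tower_weyl tow.
have [phi [phir phiZ0]] := tower_hom tow.
have phiZ c i : phi (Z c i) = gwz one c i by exact: phiZ0.
have [ev [evC evX]] := gw_hom iota Z.
(* With surjectivity of [ev], this identifies the kernel of [phi] as the image of [gw_ideal one],
   that is, the combinations of the [y_i x_i - 1]. *)
have phi_ev f : phi (ev f) = kpi (gw_ideal one) f.
  move: f; apply: gw_var_generated.
  - move=> _ [[r ->]|[c [i ->]]]; first by rewrite evC phir.
    by rewrite evX phiZ gwzE.
  - by move=> x y xE yE; rewrite !rmorphD /= xE yE.
  by move=> x y xE yE; rewrite !rmorphM /= xE yE.
have ev_surj s : exists f, ev f = s.
  move: s; apply: gen => [_ [[r ->]|[c [i ->]]]|x y|x y].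
  - by exists r%:MP; rewrite evC.
  - by exists (gw_var R c i); rewrite evX.
  - by move=> [f <-] [g <-]; exists (f + g); rewrite rmorphD.
  by move=> [f <-] [g <-]; exists (f * g); rewrite rmorphM.
have phi_surj : forall x, exists s, phi s = x.
  apply: gw_ring_surj => [r|c i]; first by exists (iota r); rewrite phir.
  by exists (Z c i); rewrite phiZ.
have [|br [brP brE]] := bracket_pushforward phi_surj.
  move=> x y; have [f <-] := ev_surj y; rewrite phi_ev => /eqP.
  rewrite kpi_eq0 => /boolp.asboolP[c ->].
  rewrite rmorph_sum (big_morph _ (pbrDr x) (pbr0r x)).
  rewrite rmorph_sum big1 // => i _.
  rewrite rmorphM rmorphB rmorphM /= evC rmorph1.
  rewrite (evX true i : ev 'X_(rshift n i) = _).
  rewrite (evX false i : ev 'X_(lshift n i) = _).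
  (* As [y_i x_i - 1] is Poisson central, only the bracket with its coefficient survives, still
     multiplied by the relation. *)
  rewrite pbrMr (der_alongB (pbr_der x)) (laurent_casimir rel gen) pbr1r.
  rewrite subrr mulr0 addr0.
  by rewrite rmorphM rmorphB rmorphM /= !phiZ gwz_mul !rmorph1 subrr mulr0.
exists br, brP; split=> [r s|c i r|s t i j ij|i]; rewrite /pbr /=.
- by rewrite -!phir brE (weyl_base rel).
- by rewrite -!phir -phiZ brE (weyl_rz rel) linearZ rmorphM /= phir.
- by rewrite -!phiZ brE (weyl_zz rel) // linearZ rmorphM.
by rewrite -[gwy _ _]/(gwz one true i) -[gwx _ _]/(gwz one false i) -!phiZ brE
  (weyl_yx rel) phir.
Qed.

End SkewLaurent.

(** * TGWPA data and the two statements *)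

Section Tgwpa.
Variables (k : fieldType) (R : poissonAlg k) (n : nat) (d : 'I_n -> R -> R).
Variables (a : 'I_n -> R) (mu gamma : 'I_n -> 'I_n -> k).
Hypothesis datum : tgwpa_datum d a mu gamma.

Let one : 'I_n -> R := fun=> 1.
Let b (i : 'I_n) : R := d i (a i).

Definition tgwpa_q (s t : bool) (i j : 'I_n) : k :=
  match s, t with
  | false, false => gamma i j - mu i j
  | true, false => mu i j
  | false, true => - mu j i
  | true, true => mu j i - gamma i j
  end.

Lemma tgwpa_gammaE (i j : 'I_n) : i != j ->
  gamma j i = mu i j + mu j i - gamma i j.
Proof. by move=> ij; rewrite -(tgwpa_compat datum ij) addrC addKr. Qed.

(** For two generators of the same kind this is the condition on [gamma] and [mu]; for mixed kinds
    it holds by definition. *)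
Lemma tgwpa_q_skew s t (i j : 'I_n) : i != j ->
  tgwpa_q s t i j = - tgwpa_q t s j i.
Proof.
by move=> ij; case: s t => [] []; rewrite /tgwpa_q ?(tgwpa_gammaE ij); ring.
Qed.

(** Apply [d i] to [{a_i, r} = 0]. *)
Lemma tgwpa_b_central i : poisson_central (b i).
Proof.
move=> r; have := (tgwpa_der datum i).2 (a i) r.
rewrite !(tgwpa_central datum) addr0 => <-.
exact: der_along0 (tgwpa_der datum i).1.
Qed.

(** Since [d i] and [d j] commute, [b j] has the eigenvalue [gamma j i] of [a j] under [d i]; the
    two weights add up to it, with sign [(-1) ^+ c]. *)
Lemma tgwpa_d_b (c : bool) (i j : 'I_n) : i != j ->
  (-1) ^+ c *: d i (b j) = (tgwpa_q false c j i + tgwpa_q true c j i) *: b j.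
Proof.
move=> ij; have ji : j != i by rewrite eq_sym.
rewrite /b (tgwpa_derC datum) (tgwpa_eigen datum ji).
rewrite (der_alongZ (tgwpa_der datum j).1) scalerA; congr (_ *: _).
by case: c; rewrite /tgwpa_q ?(tgwpa_gammaE ij) /=; ring.
Qed.

Lemma tgwpa_weyl (br : gw_ring a -> gw_ring a -> gw_ring a)
    (brP : is_poisson br) : tgwpa_bracket d a mu gamma br ->
  weyl_relations d b tgwpa_q (A := PoissonAlg brP) (gwC a) (gwz a).
Proof.
case=> base rx ry yx yx_neq xx yy.
split=> [r s|c i r|s t i j ij|i].
- exact: base.
- by case: c; rewrite ?expr0 ?expr1 ?scale1r ?scaleN1r; [exact: ry|exact: rx].
- case: s t => [] [].
  + exact: yy.
  + by rewrite mulrC; exact: yx_neq.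
  + rewrite pbrC scaleNr mulrC; congr (- _).
    by rewrite mulrC; apply: yx_neq; rewrite eq_sym.
  exact: xx.
exact: yx.
Qed.

(** Off the diagonal, the weight of [{x_i, x_j}]. The diagonal is set to 0 because the data do not
    constrain [gamma i i] and [mu i i]. *)
Definition laurent_p (i j : 'I_n) : k :=
  if i == j then 0 else gamma i j - mu i j.

Lemma laurent_p_skew i j : laurent_p i j = - laurent_p j i.
Proof.
rewrite /laurent_p (eq_sym j i); case: eqVneq => [_|ij]; first by rewrite oppr0.
by rewrite (tgwpa_gammaE ij); ring.
Qed.

Definition tgwpa_laurent (c : bool) (i : 'I_n) : laurent_ring R n :=
  (if c then gwC one (a i) else 1) * gwz one c i.

Lemma tgwpa_laurent_weyl
    (br : laurent_ring R n -> laurent_ring R n -> laurent_ring R n)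
    (brP : is_poisson br) :
  weyl_relations d (fun=> 0) (laurent_q laurent_p) (A := PoissonAlg brP)
    (gwC one) (gwz one) ->
  weyl_relations d b tgwpa_q (A := PoissonAlg brP) (gwC one) tgwpa_laurent.
Proof.
move=> rel; pose L := PoissonAlg brP.
pose C : R -> L := gwC one; pose Z : bool -> 'I_n -> L := gwz one.
pose w (c : bool) (i : 'I_n) : L := if c then C (a i) else 1.
have CM x y : C (x * y) = C x * C y by exact: rmorphM.
have CZ c x : C (c *: x) = c *: C x by exact: linearZ.
have brCC x y : pbr (C x) (C y) = C (pbr x y) by exact: (weyl_base rel).
have brCZ (c : bool) i x : pbr (C x) (Z c i) = (-1) ^+ c *: (C (d i x) * Z c i).
  exact: (weyl_rz rel).
have brZZ s t (i j : 'I_n) : i != j ->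
    pbr (Z s i) (Z t j) = laurent_q laurent_p s t i j *: (Z s i * Z t j).
  exact: (weyl_zz rel).
have brZyx i : pbr (Z true i) (Z false i) = 0.
  by rewrite (weyl_yx rel) rmorph0.
have Zyx i : Z true i * Z false i = 1.
  by rewrite /Z gwz_mul; exact: rmorph1.
have brCw c i x : pbr (C x) (w c i) = 0.
  case: c; rewrite /w ?pbr1r // brCC pbrC (tgwpa_central datum) oppr0.
  exact: rmorph0.
have brww s t i j : pbr (w s i) (w t j) = 0.
  by case: s; [exact: brCw|rewrite /w pbr1l].
have brwZ (s t : bool) (i j : 'I_n) : i != j ->
    pbr (w s i) (Z t j) =
    ((-1) ^+ t * (if s then gamma i j else 0)) *: (w s i * Z t j).
  move=> ij; case: s; rewrite /w; last by rewrite pbr1l mulr0 scale0r.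
  by rewrite brCZ (tgwpa_eigen datum ij) CZ -scalerAl scalerA.
have brZw (s t : bool) (i j : 'I_n) : i != j ->
    pbr (Z s i) (w t j) =
    - (((-1) ^+ s * (if t then gamma j i else 0)) *: (w t j * Z s i)).
  by move=> ij; rewrite pbrC brwZ // eq_sym.
have wZ c i : tgwpa_laurent c i = w c i * Z c i by [].
split=> [r s|c i r|s t i j ij|i].
- exact: brCC.
- by rewrite wZ pbrMr brCw brCZ mul0r add0r -scalerAr mulrCA.
- rewrite !wZ !(pbrMr, pbrMl) brww brwZ // brZw // brZZ //.
  (* The three contributions are [a_i] against the generator of index [j], the generator of index
     [i] against [a_j], and the two Laurent generators. *)
  have -> : tgwpa_q s t i j = (-1) ^+ t * (if s then gamma i j else 0)
      - (-1) ^+ s * (if t then gamma j i else 0) + laurent_q laurent_p s t i j.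
    rewrite /laurent_q /laurent_p (negPf ij).
    by case: s t => [] []; rewrite /tgwpa_q /= ?(tgwpa_gammaE ij); ring.
  (* Scaling is turned into multiplication by an abstract element so that [ring] applies. *)
  have [e eE] : exists e : k -> L, forall c x, c *: x = e c * x.
    by exists (fun c => c%:A) => c x; rewrite mulr_algl.
  rewrite !scalerDl scaleNr !eE; ring.
rewrite !wZ /w mul1r pbrMl brZyx brCZ scale1r mulr0 addr0 -mulrA.
by rewrite (mulrC (Z false i)) Zyx mulr1.
Qed.

End Tgwpa.

Theorem theorem1 (k : fieldType) (R : poissonAlg k) (n : nat)
  (n_ge1 : (1 <= n)%N) (d : 'I_n -> R -> R) (a : 'I_n -> R)
  (mu gamma : 'I_n -> 'I_n -> k) (datum : tgwpa_datum d a mu gamma)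
  (br : gw_ring a -> gw_ring a -> gw_ring a) (brP : is_poisson br)
  (br_tgwpa : tgwpa_bracket d a mu gamma br) :
  (exists S : poissonAlg k, iterated_ore R S /\
     exists (I : idealr S) (hI : poisson_ideal I),
       poisson_isomorphic (PoissonAlg brP) (poisson_quot hI)) /\
  (exists p : 'M[k]_n, p^T = - p /\
     exists (brL : laurent_ring R n -> laurent_ring R n -> laurent_ring R n)
            (brLP : is_poisson brL),
       skew_laurent_bracket d p brL /\
       exists B : {pred PoissonAlg brLP}, poisson_subalgebra B /\
       exists phi : {lrmorphism PoissonAlg brP -> PoissonAlg brLP},
         poisson_morphism phi /\ injective phi /\
         (forall w, w \in B <-> exists v, phi v = w)).
Proof.
have d_der := tgwpa_der datum; have dC := tgwpa_derC datum.
have relA := tgwpa_weyl brP br_tgwpa.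
split.
  (* The target of [tower_hom] is [A] itself with its own generators. *)
  have [S [iota [Z tow]]] := tower_exists d_der dC (tgwpa_b_central datum)
    (tgwpa_q_skew datum) (tgwpa_d_b datum) (gwC a) (gwz a).
  have [rel gen] := tower_weyl tow.
  have [phi [phir phiZ]] := tower_hom tow.
  exists S; split; first exact: tower_ore tow.
  apply: (@poisson_first_isomorphism _ _ (PoissonAlg brP) phi).
    by apply: (weyl_morphism rel relA gen) => // c i; exact: phiZ.
  apply: gw_ring_surj => [r|c i]; first by exists (iota r).
  by exists (Z c i); rewrite phiZ.
have p_skew := laurent_p_skew datum.
exists (\matrix_(i, j) laurent_p mu gamma i j); split.
  by apply/matrixP => i j; rewrite !mxE.
have [brL [brLP relL]] := skew_laurent_exists d_der dC p_skew.
have relT := tgwpa_laurent_weyl datum relL.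
exists brL, brLP; split.
  have zz s t (i j : 'I_n) : i != j -> brL (gwz _ s i) (gwz _ t j) = _ :=
    @weyl_zz _ _ _ _ _ _ _ _ _ relL s t i j.
  split.
  - exact: (weyl_base relL).
  - by move=> i r; have := weyl_rz relL false i r; rewrite expr0 scale1r.
  - by move=> i r; have := weyl_rz relL true i r; rewrite expr1 scaleN1r.
  - by move=> i j ij; rewrite mxE; have := zz false false i j ij;
      rewrite /laurent_q expr0 mul1r.
  by move=> i j ij; rewrite mxE; have := zz false true i j ij;
    rewrite /laurent_q expr1 mulN1r scaleNr.
have [phi [phir phiZ]] : exists g : {lrmorphism gw_ring a -> laurent_ring R n},
    (forall r, g (gwC a r) = gwC (fun=> 1) r) /\
    forall c i, g (gwz a c i) = tgwpa_laurent a c i.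
  (* The relation is respected because [a_i t_i^-1 t_i = a_i]. *)
  apply: gw_ring_lift => i.
  by rewrite /tgwpa_laurent mul1r -mulrA gwz_mul rmorph1 mulr1.
pose B : {pred PoissonAlg brLP} := fun w => boolp.asbool (exists v, phi v = w).
have BP w : w \in B <-> exists v, phi v = w by split=> /boolp.asboolP.
have phi_morph : @poisson_morphism _ (PoissonAlg brP) (PoissonAlg brLP) phi.
  exact: (weyl_morphism relA relT (@gw_generated _ _ _ a)).
have phi_inj : injective phi.
  apply: (gw_ring_rescale_inj (tgwpa_regular datum) phir) => i.
    by have := phiZ false i; rewrite /tgwpa_laurent mul1r.
  exact: (phiZ true i).
exists B; split; last first.
  by exists phi; split; [exact: phi_morph|split; [exact: phi_inj|exact: BP]].
split; first split.
- by apply/BP; exists 1; rewrite rmorph1.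
- move=> c u v /BP[x <-] /BP[y <-]; apply/BP; exists (c *: x + y).
  exact: linearP.
- by move=> u v /BP[x <-] /BP[y <-]; apply/BP; exists (x * y); rewrite rmorphM.
move=> u v /BP[x <-] /BP[y <-]; apply/BP.
by exists (br x y); rewrite -phi_morph.
Qed.
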